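(* Let $f\in C(\mathbb{R};\mathbb{R})$ satisfy $xf(x)>0$ for all $x\ne0$ and $f(0)=0$, and let $\sigma\in C([0,\infty);\mathbb{R})$. Let $X$ be any solution of $$dX(t)=-f(X(t))\,dt+\sigma(t)\,dB(t),\quad t\ge0;\qquad X(0)=\xi\in\mathbb{R},$$ and let $Y$ be the unique solution of $$dY(t)=-Y(t)\,dt+\sigma(t)\,dB(t),\quad t\ge0;\qquad Y(0)=0 .$$ Let $\Omega_X$ and $\Omega_Y$ be the almost sure events on which $X$, respectively $Y$, satisfies its equation. (A) If the event $\{\omega\in\Omega_Y:\lim_{t\to\infty}|Y(t,\omega)|=0\}$ is almost sure, then $\lim_{t\to\infty}X(t)=0$ a.s. (B) If the event $\Omega_1=\{\omega\in\Omega_Y:0<\limsup_{t\to\infty}|Y(t,\omega)|<+\infty\}$ is almost sure, then the event $\Omega_2=\Omega_1\cap\Omega_X$ is almost sure, and there exists a positive and deterministic $\underline{X}$ given by $$\underline{X}=\inf_{\omega\in\Omega_2}\ \limsup_{t\to\infty}|X(t,\omega)|.$$ (C) If the event $\{\omega\in\Omega_Y:\limsup_{t\to\infty}|Y(t,\omega)|=+\infty\}$ is almost sure, then $\limsup_{t\to\infty}|X(t)|=+\infty$ a.s.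
   Context: $(\Omega,\mathcal{F},(\mathcal{F}(t))_{t\ge0},\mathbb{P})$ is a complete filtered probability space and $B$ a standard one-dimensional Brownian motion adapted to the filtration. A solution $X$ is any continuous adapted process on $[0,\infty)$ with, a.s., $X(t)=\xi-\int_0^tf(X(s))\,ds+\int_0^t\sigma(s)\,dB(s)$ for all $t\ge0$ (uniqueness is not assumed), and similarly for $Y$, which is the unique continuous adapted process obeying its equation. The infimum in (B) is the pointwise infimum over the event $\Omega_2$.
   Formalization: In (B) the infimum is taken over Ω₂ after discarding a suitable null set (its value is unchanged by discarding more) and may be +∞; over all of Ω₂ it can be 0, e.g. f(x)=x, ξ=0, σ(t)=1/√log(e+t), where paths with Y=ε sin t belong to Ω₂. *)

(* Defs.v *)
From HB Require Import structures.
From mathcomp Require Import all_boot all_order all_algebra.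
From mathcomp Require Import all_classical all_reals all_analysis.

Set Implicit Arguments.
Unset Strict Implicit.
Unset Printing Implicit Defensive.

Import Order.TTheory GRing.Theory Num.Theory.
Import numFieldNormedType.Exports.

Local Open Scope classical_set_scope.
Local Open Scope ring_scope.

(* Processes and filtrations are indexed by R; only the times t >= 0 are ever
   constrained or used. *)
Section processes.
Context {R : realType} {d : measure_display} {T : measurableType d}.
Implicit Types (P : probability T R) (F : R -> set (set T)).
Implicit Types (B H I X : R -> T -> R).

Definition almost_sure P (E : set T) : Prop := measurable E /\ P E = 1%E.

Definition filtration F : Prop :=
  [/\ forall t, 0 <= t -> sigma_algebra setT (F t),
      forall t, 0 <= t -> F t `<=` measurable
    & forall s t, 0 <= s -> s <= t -> F s `<=` F t].

Definition complete_filtered_probability P F : Prop :=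
  [/\ filtration F, measure_is_complete P & forall N, P.-negligible N -> F 0 N].

Definition measurable_wrt (G : set (set T)) (Z : T -> R) : Prop :=
  forall A : set R, measurable A -> G (Z @^-1` A).

Definition continuous_adapted F X : Prop :=
  (forall w, {within `[0, +oo[, continuous (fun t => X t w)}) /\
  (forall t, 0 <= t -> measurable_wrt (F t) (X t)).

(* [normal_prob] takes the standard deviation as its second parameter. *)
Definition brownian_motion P F B : Prop :=
  [/\ continuous_adapted F B,
      almost_sure P [set w | B 0 w = 0],
      forall s t, 0 <= s -> s < t -> forall A : set R, measurable A ->
        P [set w | A (B t w - B s w)] = normal_prob 0 (Num.sqrt (t - s)) A
    & forall s t, 0 <= s -> s < t ->
        forall (G : set T) (A : set R), F s G -> measurable A ->
        P (G `&` [set w | A (B t w - B s w)]) =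
          (P G * P [set w | A (B t w - B s w)%R])%E].

(* The elementary process on [0, t]
     phi_s = \sum_(i < n) coef i * 1_[time i, time i.+1[(s),
   where coef i is bounded and F (time i)-measurable. *)
Record elementary F (t : R) := Elementary {
  steps : nat ;
  time : nat -> R ;
  coef : nat -> T -> R ;
  time_first : time 0%N = 0 ;
  time_last : time steps = t ;
  time_mono : forall i, (i < steps)%N -> time i <= time i.+1 ;
  coef_meas : forall i, (i < steps)%N -> measurable_wrt (F (time i)) (coef i) ;
  coef_bound : forall i, (i < steps)%N -> exists M, forall w, `|coef i w| <= M
}.

Definition elementary_val F t (phi : elementary F t) (s : R) (w : T) : R :=
  \sum_(i < steps phi)
    coef phi i w * \1_(`[time phi i, time phi i.+1[%classic) s.

Definition elementary_int B F t (phi : elementary F t) (w : T) : R :=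
  \sum_(i < steps phi) coef phi i w * (B (time phi i.+1) w - B (time phi i) w).

(* I is a continuous adapted version of t |-> \int_0^t H dB: I t is the L^2(P)
   limit of the integrals of elementary processes converging to H in
   L^2(P x ds) on [0, t]. *)
Definition ito_integral P F B H I : Prop :=
  continuous_adapted F I /\
  forall t, 0 <= t -> forall e : R, 0 < e -> exists2 del : R, 0 < del &
    forall phi : elementary F t,
      (\int[P]_w \int[lebesgue_measure]_(s in `[0%R, t])
          ((elementary_val phi s w - H s w) ^+ 2)%:E < del%:E)%E ->
      (\int[P]_w ((elementary_int B phi w - I t w) ^+ 2)%:E < e%:E)%E.

(* The paths of X satisfying dX = - f(X) dt + dI, X(0) = x0. *)
Definition equation_event (f : R -> R) (x0 : R) I X : set T :=
  [set w | forall t, 0 <= t ->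
     X t w = x0 - \int[lebesgue_measure]_(s in `[0, t]) f (X s w) + I t w].

Definition solution P F (f : R -> R) (x0 : R) I X : Prop :=
  continuous_adapted F X /\ almost_sure P (equation_event f x0 I X).

Definition limsup_abs X (w : T) : \bar R :=
  limf_esup (fun t => `|X t w|%:E) +oo.

End processes.

(* Main.v *)
Require Import Defs.
From HB Require Import structures.
From mathcomp Require Import all_boot all_order all_algebra.
From mathcomp Require Import all_classical all_reals all_analysis.
From mathcomp Require Import measurable_realfun ess_sup_inf lra ring.
Set Implicit Arguments.
Unset Strict Implicit.
Unset Printing Implicit Defensive.
Import Order.TTheory GRing.Theory Num.Theory.
Import numFieldNormedType.Exports.
Local Open Scope classical_set_scope.
Local Open Scope ring_scope.

(** Three facts carry the proof.

    1. The increments of [I] are limits in probability of sums of weighted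
    Brownian increments; hence they are symmetric and independent of the past.
    Neither their Gaussian law nor their variance is needed.

    2. Levy's maximal inequality for such increments gives, for [A] in the past
    of [s], P(A, sup (I - I_s) = oo) <= 2 P(A, inf (I - I_s) = -oo).  With
    [A] the event that [I] is at least [-K] up to time [s], and [s] tending to
    infinity, a path of [I] that is bounded below is a.s. bounded above, and
    conversely.  So [|X|] cannot stay away from [0]: if [X >= e] eventually,
    then [I] is bounded below, hence above, so [X] is bounded, [f (X)] is bounded
    below by a positive constant, and its integral diverges.  Once [Y] is small,
    [X - Y] cannot leave a neighbourhood of [0] to which [X] returns, whence (A).

    3. Pathwise, a bound on [X] bounds the oscillation of [I] over unit intervals,
    which in turn bounds [Y]; this is (C).  For (B), the Borel-Cantelli lemmas
    applied to the independent variables [I (n+1) - I n] show that either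
    [|I (n+1) - I n| > e] infinitely often a.s. for some deterministic [e], which
    forces [limsup |X|] above a constant depending only on [e] and [f]; or, by
    Levy's inequality, the oscillation of [I] over [[n, n+1]] tends to [0] a.s.,
    hence so does [Y].  The infimum in (B) is the essential infimum of
    [limsup |X|]. *)

(** * Symmetric variables independent of a sigma-algebra *)

Lemma preimage_measurable d d' (T : measurableType d) (T' : measurableType d')
    (D : T -> T') (C : set T') :
  measurable_fun setT D -> measurable C -> measurable (D @^-1` C).
Proof. by move=> mD mC; rewrite -[X in measurable X]setTI; exact: mD. Qed.

(* [distribution] is restricted to probabilities, whereas laws are also taken on
   an event, under a restriction of [P]. *)
Definition finite_law d d' (T : measurableType d) (T' : measurableType d')
    (R : realType) (mu : set T -> \bar R) (X : {mfun T >-> T'}) :=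
  pushforward mu X.

Section finite_law_measure.
Context d d' (T : measurableType d) (T' : measurableType d') (R : realType).
Context (mu : {finite_measure set T -> \bar R}) (X : {mfun T >-> T'}).

Let finite_law0 : finite_law mu X set0 = 0%E.
Proof. exact: measure0. Qed.

Let finite_law_ge0 A : (0 <= finite_law mu X A)%E.
Proof. exact: measure_ge0. Qed.

Let finite_law_sigma_additive : semi_sigma_additive (finite_law mu X).
Proof. exact: measure_semi_sigma_additive. Qed.

HB.instance Definition _ := isMeasure.Build _ _ _ (finite_law mu X)
  finite_law0 finite_law_ge0 finite_law_sigma_additive.

Let finite_law_fin : fin_num_fun (finite_law mu X).
Proof.
move=> A mA; apply: fin_num_measure.
by rewrite -[X in measurable X]setTI; exact: measurable_funPT.
Qed.

HB.instance Definition _ :=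
  Measure_isFinite.Build _ _ _ (finite_law mu X) finite_law_fin.

End finite_law_measure.

Section independence.
Context {R : realType} {d : measure_display} {T : measurableType d}.
Variable P : probability T R.
Implicit Types (G : set (set T)) (D : T -> R).

Lemma measurable_wrt_fun G D :
  G `<=` measurable -> measurable_wrt G D -> measurable_fun setT D.
Proof. by move=> GM GD _ C mC; rewrite setTI; exact/GM/GD. Qed.

(** Independence and symmetry are bundled because a sum of symmetric variables is symmetric through
    the independence of its terms. *)
Definition indep_sym G D :=
  [/\ measurable_fun setT D,
      forall A C, G A -> measurable C ->
        P (A `&` D @^-1` C) = (P A * P (D @^-1` C))%E
    & forall C, measurable C -> P ((\- D) @^-1` C) = P (D @^-1` C)].

(** Uniqueness of product measures: on rectangles both sides are the law of [D1] under [P]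
    restricted to [A] times the law of [D2]. Two choices of [m'] will give independence and symmetry
    of a sum. *)
Lemma joint_lawE (A : set T) D1 D2 (m' : {measure set (R * R) -> \bar R}) :
  measurable A -> measurable_fun setT D1 -> measurable_fun setT D2 ->
  (forall C1 C2, measurable C1 -> measurable C2 ->
    P (A `&` D1 @^-1` C1 `&` D2 @^-1` C2) =
    (P (A `&` D1 @^-1` C1) * P (D2 @^-1` C2))%E) ->
  (forall C1 C2, measurable C1 -> measurable C2 ->
    m' (C1 `*` C2) = (P (A `&` D1 @^-1` C1) * P (D2 @^-1` C2))%E) ->
  forall S, measurable S -> P (A `&` (fun w => (D1 w, D2 w)) @^-1` S) = m' S.
Proof.
move=> mA mD1 mD2 prodE m'E S mS.
pose fm1 : {mfun T >-> R} := mfun_Sub (mem_set mD1).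
pose fm2 : {mfun T >-> R} := mfun_Sub (mem_set mD2).
have mD12 : measurable_fun setT (fun w => (D1 w, D2 w)).
  exact/measurable_fun_pair.
pose fm12 : {mfun T >-> (R * R)%type} := mfun_Sub (mem_set mD12).
pose m1 : {sigma_finite_measure set R -> \bar R} := finite_law (mrestr P mA) fm1.
pose m2 : {sigma_finite_measure set R -> \bar R} := finite_law P fm2.
pose m12 : {measure set (R * R) -> \bar R} := finite_law (mrestr P mA) fm12.
have m1E C1 C2 : (P (A `&` D1 @^-1` C1) * P (D2 @^-1` C2) = m1 C1 * m2 C2)%E.
  by rewrite setIC.
transitivity ((m1 \x m2)%E S).
  rewrite setIC; apply/esym.
  apply: (product_measure_unique (m' := m12)) => // B C mB mC.
  rewrite -m1E -prodE//.
  change (P ((fun w => (D1 w, D2 w)) @^-1` (B `*` C) `&` A) =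
    P (A `&` D1 @^-1` B `&` D2 @^-1` C)).
  by congr (P _); apply/seteqP; split => w /= [] // [].
by apply: product_measure_unique => // B C mB mC; rewrite -m1E m'E.
Qed.

(** As [D1] is [G']-measurable, [D2] is independent of [A] and [D1] jointly for [A] in [G]. So on
    [A] the pair has [P A] times its law, and the opposite pair has the same law; both facts pass to
    the image under addition. *)
Lemma indep_symD G G' D1 D2 :
  G setT -> G `<=` G' -> G' `<=` measurable -> setI_closed G' ->
  measurable_wrt G' D1 -> indep_sym G D1 -> indep_sym G' D2 ->
  indep_sym G (D1 \+ D2).
Proof.
move=> GT GG' G'm G'I G'D1 [mD1 i1 s1] [mD2 i2 s2].
have mD12 : measurable_fun setT (fun w => (D1 w, D2 w)).
  exact/measurable_fun_pair.
pose fm12 : {mfun T >-> (R * R)%type} := mfun_Sub (mem_set mD12).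
have prodE A C1 C2 : G A -> measurable C1 -> measurable C2 ->
    P (A `&` D1 @^-1` C1 `&` D2 @^-1` C2) =
    (P (A `&` D1 @^-1` C1) * P (D2 @^-1` C2))%E.
  by move=> GA mC1 mC2; rewrite i2//; apply: G'I; [exact: GG'|exact: G'D1].
have mS C : measurable C -> measurable [set xy : (R * R)%type | C (xy.1 + xy.2)].
  apply: preimage_measurable; apply: measurable_funD.
    exact: measurable_fst.
  exact: measurable_snd.
split; first exact: measurable_funD.
  move=> A C GA mC; have mA : measurable A by exact/G'm/GG'.
  pose r : {nonneg R} := NngNum (fine_ge0 (measure_ge0 P A)).
  have rE : r%:num%:E = P A by rewrite /= fineK// fin_num_measure.
  pose m' : {measure set (R * R) -> \bar R} := mscale r (finite_law P fm12).
  transitivity (m' [set xy | C (xy.1 + xy.2)]).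
    apply: (joint_lawE (m' := m') mA mD1 mD2) => // [C1 C2|C1 C2 mC1 mC2|].
    - exact: prodE.
    - rewrite /m' /= /mscale rE i1// -muleA; congr (_ * _)%E.
      have := prodE setT C1 C2 GT mC1 mC2; rewrite !setTI => <-.
      by congr (P _).
    - exact: mS.
  by rewrite /m' /= /mscale rE.
move=> C mC.
have mN D : measurable_fun setT D -> measurable_fun setT (\- D).
  exact: measurable_funN.
have mND12 : measurable_fun setT (fun w => (- D1 w, - D2 w)).
  by apply/measurable_fun_pair; exact: mN.
pose fmN : {mfun T >-> (R * R)%type} := mfun_Sub (mem_set mND12).
pose m' : {measure set (R * R) -> \bar R} := finite_law P fmN.
transitivity (m' [set xy | C (xy.1 + xy.2)]).
  congr (P _); apply/seteqP; split => w /=; rewrite ?opprD//.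
apply/esym; rewrite -[in LHS](setTI (_ @^-1` C)).
apply: (joint_lawE (m' := m') measurableT mD1 mD2) => // [C1 C2|C1 C2 mC1 mC2|].
- exact: prodE.
- have := prodE setT (-%R @^-1` C1) (-%R @^-1` C2) GT.
  rewrite !setTI -(s1 C1)// -(s2 C2)//; apply.
  + exact: preimage_measurable.
  + exact: preimage_measurable.
- exact: mS.
Qed.

Lemma indep_symZ G D (a : R) : indep_sym G D -> indep_sym G (fun w => a * D w).
Proof.
move=> [mD iD sD].
have mM : measurable_fun setT (fun x : R => a * x) by exact: measurable_funM.
have mP C : measurable C -> measurable ((fun x => a * x) @^-1` C).
  by move=> mC; rewrite -[X in measurable X]setTI; exact: mM.
split=> [|A C GA mC|C mC].
- exact: (measurableT_comp mM).
- exact: (iD A _ GA (mP _ mC)).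
- rewrite -[RHS](sD _ (mP _ mC)); congr (P _).
  by apply/seteqP; split => w /=; rewrite mulrN.
Qed.

Lemma indep_sym0 G : G `<=` measurable -> indep_sym G (fun=> 0).
Proof.
move=> Gm; split => [|A C GA mC|C mC]; first exact: measurable_cst.
- rewrite preimage_cst; case: ifPn => _.
  + by rewrite setIT probability_setT mule1.
  + by rewrite setI0 measure0 mule0.
- by congr (P _); apply/seteqP; split => w /=; rewrite oppr0.
Qed.

End independence.

(** * Limits in probability *)

Section real_probability.
Context {R : realType} {d : measure_display} {T : measurableType d}.
Variable P : probability T R.
Implicit Types A B : set T.

Definition pr A : R := fine (P A).

Lemma prE A : measurable A -> P A = (pr A)%:E.
Proof. by move=> mA; rewrite /pr fineK// fin_num_measure. Qed.

Lemma pr_ge0 A : 0 <= pr A.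
Proof. exact/fine_ge0/measure_ge0. Qed.

Lemma le_pr A B : measurable A -> measurable B -> A `<=` B -> pr A <= pr B.
Proof.
by move=> mA mB AB; rewrite -lee_fin -!prE//; apply: le_measure; rewrite ?inE.
Qed.

Lemma pr_le1 A : measurable A -> pr A <= 1.
Proof. by move=> mA; rewrite -lee_fin -prE// probability_le1. Qed.

Lemma prID A B : measurable A -> measurable B ->
  pr A = pr (A `&` B) + pr (A `\` B).
Proof.
move=> mA mB; apply/EFin_inj; rewrite EFinD -!prE//.
- by rewrite addeC -measureDI.
- exact: measurableD.
- exact: measurableI.
Qed.

Lemma prU_le A B : measurable A -> measurable B -> pr (A `|` B) <= pr A + pr B.
Proof.
move=> mA mB; rewrite -lee_fin EFinD -!prE//; first exact: measureU2.
exact: measurableU.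
Qed.

Lemma pr_cover A B C : measurable A -> measurable B -> measurable C ->
  A `<=` B `|` C -> pr A <= pr B + pr C.
Proof.
move=> mA mB mC ABC; apply: le_trans (prU_le mB mC).
by apply: le_pr => //; exact: measurableU.
Qed.

Lemma prC A : measurable A -> pr (~` A) = 1 - pr A.
Proof.
by move=> mA; rewrite /pr probability_setC// fineB// fin_num_measure.
Qed.

Lemma pr_bigcup_le (E : (set T)^nat) k :
  (forall n, measurable (E n)) -> nondecreasing_seq E ->
  (forall n, pr (E n) <= k) -> pr (\bigcup_n E n) <= k.
Proof.
move=> mE ndE Ek; have mU : measurable (\bigcup_n E n) by exact: bigcup_measurable.
rewrite -lee_fin -prE//.
have /cvg_lim <- // := @nondecreasing_cvg_mu _ _ _ P _ mE mU ndE.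
apply: lime_le.
  by apply/cvg_ex; exists (P (\bigcup_n E n)); exact: nondecreasing_cvg_mu.
by apply: nearW => n /=; rewrite prE// lee_fin.
Qed.

Lemma pr_bigcap_cvg (E : (set T)^nat) :
  (forall n, measurable (E n)) -> nonincreasing_seq E ->
  pr (E n) @[n --> \oo] --> pr (\bigcap_n E n).
Proof.
move=> mE niE; have mI : measurable (\bigcap_n E n) by exact: bigcap_measurable.
apply: (@fine_cvg _ _ _ _ (P \o E)); rewrite -prE//.
apply: nonincreasing_cvg_mu => //.
by rewrite ltey_eq fin_num_measure.
Qed.

Lemma gtr_measurable (D : T -> R) c :
  measurable_fun setT D -> measurable [set w | c < D w].
Proof.
move=> mD; rewrite (_ : [set w | _] = D @^-1` `]c, +oo[); last first.
  by apply/seteqP; split => w /=; rewrite in_itv/= andbT.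
exact: preimage_measurable.
Qed.

(** Continuity from below along [c + 1/(n+1)]. It absorbs the shift of level by [e] that a limit in
    probability costs. *)
Lemma pr_gtr_le A (D : T -> R) c k : measurable A -> measurable_fun setT D ->
  (forall e, 0 < e -> pr (A `&` [set w | c + e < D w]) <= k) ->
  pr (A `&` [set w | c < D w]) <= k.
Proof.
move=> mA mD H.
rewrite (_ : _ `&` _ = \bigcup_n (A `&` [set w | c + n.+1%:R^-1 < D w])).
  apply: pr_bigcup_le => [n|m n mn|n].
  - by apply: measurableI => //; exact: gtr_measurable.
  - apply/subsetPset => w [Aw] /= h; split => //=; apply: le_lt_trans h.
    by rewrite lerD2l lef_pV2 ?posrE// ler_nat ltnS.
  - by apply: H; rewrite invr_gt0.
apply/seteqP; split => [w [Aw /= cD]|w [n _ [Aw /= cD]]].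
  have [n nD] := ltr_add_invr cD.
  by exists n.
split=> //=; apply: lt_trans cD; by rewrite ltrDl invr_gt0.
Qed.

End real_probability.

Section limit_in_probability.
Context {R : realType} {d : measure_display} {T : measurableType d}.
Variable P : probability T R.
Notation pr := (pr P).

(** The closure of [S] for convergence in probability, the exceptional event being enlarged to a
    measurable [N]. *)
Definition prob_limit (S : set (T -> R)) (D : T -> R) := forall e eta : R,
  0 < e -> 0 < eta -> exists2 D', S D' &
    exists2 N, measurable N /\ pr N <= eta &
      forall w, ~ N w -> `|D' w - D w| <= e.

Lemma prob_limitN G D :
  prob_limit (indep_sym P G) D -> prob_limit (indep_sym P G) (\- D).
Proof.
move=> DD e eta e0 eta0; have [D' D'G [N mN ND]] := DD _ _ e0 eta0.
exists (fun w => -1 * D' w); first exact: indep_symZ.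
by exists N => // w Nw; rewrite mulN1r -opprD normrN; exact: ND.
Qed.

(** Off the exceptional event [D] and [D'] are within [e], so their tails compare after a shift of
    level. One [D'] serves all [B] and [x], because independence uses it on [A] and on the whole
    space at once. *)
Lemma prob_limit_tail G D e eta : G `<=` measurable -> measurable_fun setT D ->
  prob_limit (indep_sym P G) D -> 0 < e -> 0 < eta ->
  exists2 D', indep_sym P G D' & forall B x, measurable B ->
    pr (B `&` [set w | x + e < D w]) <= pr (B `&` [set w | x < D' w]) + eta /\
    pr (B `&` [set w | x + e < D' w]) <= pr (B `&` [set w | x < D w]) + eta.
Proof.
move=> Gm mD DD e0 eta0; have [D' D'G [N [mN Neta] ND]] := DD _ _ e0 eta0.
have [mD' _ _] := D'G; have mDc := @gtr_measurable _ _ _ _ _ mD.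
have mD'c := @gtr_measurable _ _ _ _ _ mD'.
exists D' => // B x mB; split.
  apply: (@le_trans _ _ (pr (B `&` [set w | x < D' w]) + pr N)); last first.
    by rewrite lerD2l.
  apply: pr_cover => //; try exact: measurableI.
  move=> w [Bw /= xD]; have [Nw|/ND] := pselect (N w); first by right.
  by rewrite ler_norml => /andP[h1 h2]; left; split => //=; lra.
apply: (@le_trans _ _ (pr (B `&` [set w | x < D w]) + pr N)); last first.
  by rewrite lerD2l.
apply: pr_cover => //; try exact: measurableI.
move=> w [Bw /= xD]; have [Nw|/ND] := pselect (N w); first by right.
by rewrite ler_norml => /andP[h1 h2]; left; split => //=; lra.
Qed.

Lemma indep_sym_tail G D x : indep_sym P G D -> forall A, G A -> measurable A ->
  pr (A `&` [set w | x < D w]) = pr A * pr [set w | x < D w].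
Proof.
move=> [mD iD _] A GA mA; have := iD A `]x, +oo[%classic GA (measurable_itv _).
rewrite (_ : D @^-1` _ = [set w | x < D w]); last first.
  by apply/seteqP; split => w /=; rewrite in_itv/= andbT.
have mDx := @gtr_measurable _ _ _ _ x mD.
by rewrite !prE//; [exact: EFin_inj|exact: measurableI].
Qed.

Lemma indep_sym_tailN G D x : indep_sym P G D ->
  pr [set w | x < - D w] = pr [set w | x < D w].
Proof.
move=> [mD _ sD]; have := sD `]x, +oo[%classic (measurable_itv _).
rewrite /pr => eqP; congr fine; move: eqP; congr (P _ = P _).
  by apply/seteqP; split => w /=; rewrite in_itv/= andbT.
by apply/seteqP; split => w /=; rewrite in_itv/= andbT.
Qed.

(** The product formula is exact for an approximant; the levels [c], [c + e / 2], [c + e] carry it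
    to [D] up to [eta]. *)
Lemma prob_limit_indep G D A c : G `<=` measurable -> G A ->
  measurable_fun setT D -> prob_limit (indep_sym P G) D ->
  pr (A `&` [set w | c < D w]) = pr A * pr [set w | c < D w].
Proof.
move=> Gm GA mD DD; have mA := Gm _ GA.
have mDc := @gtr_measurable _ _ _ _ _ mD.
have A0 := pr_ge0 P A; have A1 := pr_le1 P mA.
apply/eqP; rewrite eq_le; apply/andP; split.
  apply: pr_gtr_le => // e e0; apply/ler_addgt0Pr => eta eta0.
  have [D' D'G H] := prob_limit_tail Gm mD DD
    (ltac:(lra) : 0 < e / 2) (ltac:(lra) : 0 < eta / 2).
  have [+ _] := H A (c + e / 2) mA.
  rewrite (indep_sym_tail _ D'G)// -addrA -splitr => h1.
  have [_] := H setT c measurableT; rewrite !setTI => h2.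
  by nra.
rewrite -[leLHS]mulrC -(setTI [set w | _]).
(* Dividing by [pr A] brings the bound into the form of [pr_gtr_le], so the null case is settled
   apart. *)
have [->|An0] := eqVneq (pr A) 0; first by rewrite mulr0 pr_ge0.
have {An0} Ap : 0 < pr A by rewrite lt0r An0.
rewrite -ler_pdivlMr//.
apply: pr_gtr_le => // e e0; rewrite ler_pdivlMr// setTI.
apply/ler_addgt0Pr => eta eta0.
have [D' D'G H] := prob_limit_tail Gm mD DD
    (ltac:(lra) : 0 < e / 2) (ltac:(lra) : 0 < eta / 2).
have [_] := H A c mA.
rewrite (indep_sym_tail _ D'G)// => h1.
have [+ _] := H setT (c + e / 2) measurableT; rewrite !setTI -addrA -splitr => h2.
by nra.
Qed.

Let prob_limit_sym_le G D c : G `<=` measurable ->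
  measurable_fun setT D -> prob_limit (indep_sym P G) D ->
  pr [set w | c < D w] <= pr [set w | c < - D w].
Proof.
move=> Gm mD DD; rewrite -(setTI [set w | c < D w]).
have mND : measurable_fun setT (\- D) by exact: measurable_funN.
apply: pr_gtr_le => // e e0; rewrite setTI; apply/ler_addgt0Pr => eta eta0.
have [D' D'G [N [mN Neta] ND]] := DD _ _ (ltac:(lra) : 0 < e / 2)
  (ltac:(lra) : 0 < eta / 2).
have [mD' _ _] := D'G.
have mND' : measurable_fun setT (\- D').
  exact: measurable_funN.
have h1 : pr [set w | c + e < D w] <= pr [set w | c + e / 2 < D' w] + pr N.
  apply: pr_cover => //; try exact: gtr_measurable.
  move=> w /= xD; have [Nw|/ND] := pselect (N w); first by right.
  by rewrite ler_norml => /andP[h1 h2]; left => /=; lra.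
have h2 : pr [set w | c + e / 2 < - D' w] <= pr [set w | c < - D w] + pr N.
  apply: pr_cover => //; try exact: (@gtr_measurable _ _ _ (\- _)).
  move=> w /= xD; have [Nw|/ND] := pselect (N w); first by right.
  by rewrite ler_norml => /andP[h3 h4]; left => /=; lra.
move: h1; rewrite -(indep_sym_tailN _ D'G); lra.
Qed.

Lemma prob_limit_sym G D c : G `<=` measurable ->
  measurable_fun setT D -> prob_limit (indep_sym P G) D ->
  pr [set w | c < - D w] = pr [set w | c < D w].
Proof.
move=> Gm mD DD; apply/eqP; rewrite eq_le (prob_limit_sym_le _ Gm mD DD) andbT.
have := @prob_limit_sym_le G (\- D) c Gm.
rewrite (_ : [set w | c < - (\- D) w] = [set w | c < D w]); last first.
  by apply/seteqP; split => w /=; rewrite opprK.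
apply; first exact: measurable_funN.
exact: prob_limitN.
Qed.

End limit_in_probability.

(** * Brownian sums *)

Section sub_sigma_algebra.
Context {R : realType} {d : measure_display} {T : measurableType d}.
Variable G : set (set T).
Hypothesis sG : sigma_algebra setT G.

Lemma sub_sigma_algebra_measurable :
  (measurable : set (set (g_sigma_algebraType G))) = G.
Proof. exact: sigma_algebra_id. Qed.

Lemma measurable_wrtP (Z : T -> R) :
  measurable_wrt G Z <->
  measurable_fun setT (Z : g_sigma_algebraType G -> R).
Proof.
split => mZ; first by move=> _ C mC; rewrite setTI sub_sigma_algebra_measurable; exact: mZ.
by move=> C mC; rewrite -sub_sigma_algebra_measurable; exact: preimage_measurable.
Qed.

Lemma sub_sigma_algebraT : G setT.
Proof.
have := @measurableT _ (g_sigma_algebraType G).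
by rewrite sub_sigma_algebra_measurable; exact.
Qed.

Lemma sub_sigma_algebraI : setI_closed G.
Proof.
have := @measurableI _ (g_sigma_algebraType G).
by rewrite sub_sigma_algebra_measurable; exact.
Qed.

Lemma sub_sigma_algebraC A : G A -> G (~` A).
Proof.
have := @measurableC _ (g_sigma_algebraType G).
by rewrite sub_sigma_algebra_measurable; exact.
Qed.

Lemma sub_sigma_algebraU A B : G A -> G B -> G (A `|` B).
Proof.
have := @measurableU _ (g_sigma_algebraType G).
by rewrite sub_sigma_algebra_measurable; exact.
Qed.

Lemma sub_sigma_algebra_bigcup (E : (set T)^nat) :
  (forall n, G (E n)) -> G (\bigcup_n E n).
Proof. by case: sG => _ _; apply. Qed.

Lemma measurable_wrt_cst c : measurable_wrt G (fun=> c : R).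
Proof. exact/measurable_wrtP/measurable_cst. Qed.

Lemma measurable_wrtD (Z1 Z2 : T -> R) :
  measurable_wrt G Z1 -> measurable_wrt G Z2 -> measurable_wrt G (Z1 \+ Z2).
Proof.
move=> /measurable_wrtP h1 /measurable_wrtP h2; apply/measurable_wrtP.
exact: measurable_funD.
Qed.

Lemma measurable_wrtM (Z1 Z2 : T -> R) :
  measurable_wrt G Z1 -> measurable_wrt G Z2 -> measurable_wrt G (Z1 \* Z2).
Proof.
move=> /measurable_wrtP h1 /measurable_wrtP h2; apply/measurable_wrtP.
exact: measurable_funM.
Qed.

Lemma measurable_wrtN (Z : T -> R) :
  measurable_wrt G Z -> measurable_wrt G (\- Z).
Proof.
move=> /measurable_wrtP h; apply/measurable_wrtP.
exact: measurable_funN.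
Qed.

Lemma measurable_wrtB (Z1 Z2 : T -> R) :
  measurable_wrt G Z1 -> measurable_wrt G Z2 -> measurable_wrt G (Z1 \- Z2).
Proof. by move=> h1 h2; apply: measurable_wrtD => //; exact: measurable_wrtN. Qed.

End sub_sigma_algebra.

Lemma measurable_wrtS {R : realType} {d} {T : measurableType d}
    (G G' : set (set T)) (Z : T -> R) :
  G `<=` G' -> measurable_wrt G Z -> measurable_wrt G' Z.
Proof. by move=> GG' GZ A mA; exact/GG'/GZ. Qed.

Lemma normal_probN {R : realType} (s : R) (A : set R) : s != 0 -> measurable A ->
  normal_prob 0 s (-%R @^-1` A) = normal_prob 0 s A.
Proof.
move=> s0 mA; rewrite /normal_prob.
pose g (x : R) := (normal_pdf 0 s x)%:E.
have gN x : g (- x) = g x.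
  by rewrite /g normal_pdfE// /normal_fun !subr0 sqrrN.
transitivity (\int[lebesgue_measure]_(x in -%R @^-1` A) (g \o -%R) x)%E.
  by apply: eq_integral => x _ /=; rewrite gN.
have mN : measurable_fun [set: measurableTypeR R]
  (-%R : measurableTypeR R -> measurableTypeR R) by exact: oppr_measurable.
have mg : measurable_fun A g.
  by apply/measurable_EFinP; apply: measurable_funTS; exact: measurable_normal_pdf.
have g0 : {in A, forall y, (0 <= g y)%E}.
  by move=> x _; rewrite /g lee_fin; exact: normal_pdf_ge0.
have <- := @ge0_integral_pushforward _ _ (measurableTypeR R) (measurableTypeR R)
  R _ mN lebesgue_measure A g mA mg g0.
by apply: eq_measure_integral => B mB _; exact: lebesgue_measureN.
Qed.

Section brownian.
Context {R : realType} {d : measure_display} {T : measurableType d}.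
Variables (P : probability T R) (F : R -> set (set T)) (B : R -> T -> R).
Hypothesis hF : filtration F.
Hypothesis hB : brownian_motion P F B.

Let sF t : 0 <= t -> sigma_algebra setT (F t). Proof. by case: hF => + _ _; apply. Qed.
Let mF t : 0 <= t -> F t `<=` measurable. Proof. by case: hF => _ + _; apply. Qed.
Let ndF s t : 0 <= s -> s <= t -> F s `<=` F t. Proof. by case: hF => _ _; apply. Qed.
Let FB t : 0 <= t -> measurable_wrt (F t) (B t).
Proof. by case: hB => -[_ + _ _ _]; apply. Qed.

Lemma brownian_incr_indep_sym s t : 0 <= s -> s <= t ->
  indep_sym P (F s) (fun w => B t w - B s w).
Proof.
move=> s0; rewrite le_eqVlt => /predU1P[<-|st].
  rewrite (_ : (fun w => _) = fun=> 0); first exact/indep_sym0/mF.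
  by apply/funext => w; rewrite subrr.
case: hB => _ _ lawB indB; have t0 := le_trans s0 (ltW st).
split.
- exact: (measurable_funB (measurable_wrt_fun (mF t0) (FB t0))
    (measurable_wrt_fun (mF s0) (FB s0))).
- by move=> A C FA mC; exact: indB.
- move=> C mC; have mNC : measurable ((-%R : R -> R) @^-1` C).
    exact: preimage_measurable.
  transitivity (normal_prob 0 (Num.sqrt (t - s)) (-%R @^-1` C)).
    exact: (lawB s t s0 st _ mNC).
  rewrite normal_probN; [|by rewrite gt_eqF// sqrtr_gt0 subr_gt0|by []].
  exact/esym/(lawB s t s0 st C mC).
Qed.

(** The increment after [tau n] is independent of [F (tau n)], which contains the partial sum; the
    last two conclusions feed this induction. The sum starts at [m] to represent an integral from
    [tau m] on. *)
Lemma brownian_sum_indep_sym (tau c : nat -> R) m n :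
  (forall i, 0 <= tau i) -> (forall i, (m <= i < n)%N -> tau i <= tau i.+1) ->
  (m <= n)%N ->
  let D := fun w => \sum_(m <= i < n) c i * (B (tau i.+1) w - B (tau i) w) in
  indep_sym P (F (tau m)) D /\ measurable_wrt (F (tau n)) D /\ tau m <= tau n.
Proof.
move=> tau0 + mn; elim: n mn => [|n IH] mn ndtau /=.
  move: mn; rewrite leqn0 => /eqP ->.
  rewrite (_ : (fun w => _) = fun=> 0); last first.
    by apply/funext => w; rewrite big_geq.
  split; first exact/indep_sym0/mF.
  by split => //; apply: measurable_wrt_cst; exact: sF.
move: mn; rewrite leq_eqVlt => /predU1P[->|].
  rewrite (_ : (fun w => _) = fun=> 0); last first.
    by apply/funext => w; rewrite big_geq.
  split; first exact/indep_sym0/mF.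
  by split => //; apply: measurable_wrt_cst; exact: sF.
rewrite ltnS => mn.
have [|IH1 [IH2 IH3]] := IH mn.
  by move=> i /andP[mi i_n]; apply: ndtau; rewrite mi ltnS ltnW.
have nn : tau n <= tau n.+1 by apply: ndtau; rewrite mn /=.
rewrite (_ : (fun w => _) =
    (fun w => \sum_(m <= i < n) c i * (B (tau i.+1) w - B (tau i) w)) \+
    (fun w => c n * (B (tau n.+1) w - B (tau n) w))); last first.
  by apply/funext => w; rewrite big_nat_recr.
split; [|split].
- apply: (@indep_symD _ _ _ P (F (tau m)) (F (tau n))) => //.
  + exact: (sub_sigma_algebraT (sF (tau0 _))).
  + exact: (ndF (tau0 _)).
  + exact: (mF (tau0 _)).
  + exact: (sub_sigma_algebraI (sF (tau0 _))).
  + by apply: indep_symZ; exact: (brownian_incr_indep_sym (tau0 _)).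
- apply: (measurable_wrtD (sF (tau0 _))).
    by apply: measurable_wrtS IH2; exact: (ndF (tau0 _)).
  apply: (measurable_wrtM (sF _)) => //; first exact: (measurable_wrt_cst (sF _)).
  apply: (measurable_wrtB (sF _)) => //; first exact: (FB (tau0 _)).
  by apply: measurable_wrtS (FB (tau0 n)); exact: (ndF (tau0 _)).
- exact: le_trans nn.
Qed.

End brownian.

(** * Uniform continuity, step functions and grids *)

(** Extends [h] to the whole line by the constant [h 0], so that theorems on continuous functions on
    segments apply. *)
Lemma continuous_max0 {R : realType} (h : R -> R) :
  {within `[0, +oo[, continuous h} -> continuous (fun t : R => h (Num.max 0 t)).
Proof.
move=> /subspace_continuousP hc x; rewrite /continuous_at.
have m0 : `[0%R, +oo[%classic (Num.max 0 x).
  by rewrite /= in_itv/= andbT le_max lexx.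
have cm : {for x, continuous (fun t : R => Num.max 0 t)}.
  by apply: continuous_max; [exact: cvg_cst|exact: cvg_id].
apply: (cvg_comp (fun t : R => Num.max 0 t) h _ (hc _ m0)) => U /= UA.
have : \forall t \near x, `[0%R, +oo[%classic (Num.max 0 t) -> U (Num.max 0 t).
  exact: (cm _ UA).
by apply: filterS => t; apply; rewrite /= in_itv/= andbT le_max lexx.
Qed.

Lemma unif_continuous_segment {R : realType} (g : R -> R) (a b eta : R) :
  continuous g -> 0 < eta -> exists2 del : R, 0 < del &
    forall x y, a <= x <= b -> `|x - y| < del -> `|g x - g y| < eta.
Proof.
move=> cg eta0.
have := @segment_compact R a b.
rewrite compact_near_coveringP => /(_ R 0^'+ (fun del x =>
  forall y, `|x - y| < del -> `|g x - g y| < eta)) H.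
have /H {}H : forall x, `[a, b]%classic x ->
    \forall x' \near x & i \near (0:R)^'+,
      forall y, `|x' - y| < i -> `|g x' - g y| < eta.
  move=> x _; have := cg x => /cvgrPdist_lt /(_ (eta / 2)) [|r /= r0 rP]; first lra.
  exists (ball x (r / 2), [set i | i < r / 2]); first split => /=.
  - by apply: nbhsx_ballx; lra.
  - by apply: nbhs_right_lt; lra.
  move=> [x' i]/= [bx' ir] y xy.
  have h1 : `|g x - g x'| < eta / 2.
    by apply: rP; rewrite /=; move: bx'; rewrite /ball/=; lra.
  have h2 : `|g x - g y| < eta / 2.
    apply: rP => /=; move: bx'; rewrite /ball/= => bx'.
    rewrite (_ : x - y = (x - x') + (x' - y)); last by ring.
    apply: le_lt_trans (ler_normD _ _) _; lra.
  rewrite (_ : g x' - g y = (g x - g y) - (g x - g x')); last by ring.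
  by apply: le_lt_trans (ler_normB _ _) _; lra.
have : \forall i \near (0:R)^'+, 0 < i /\ `[a, b]%classic `<=`
    (fun x => forall y, `|x - y| < i -> `|g x - g y| < eta).
  by apply: filterI => //; exact: nbhs_right_gt.
move=> /filter_ex [del [del0 Hdel]]; exists del => // x y xab.
by apply: Hdel; rewrite /= in_itv.
Qed.

Section step_functions.
Context {R : realType}.
Implicit Types (tau c : nat -> R).

Let step tau c n (u : R) :=
  \sum_(i < n) c i * \1_(`[tau i, tau i.+1[%classic) u.

(** The half-open intervals are disjoint, so at most one term survives. The vanishing from [tau n]
    on kills the earlier terms when [u] lies in the last interval. *)
Lemma step_valE tau c n u :
  (forall i, (i < n)%N -> tau i <= tau i.+1) ->
  (tau n <= u -> step tau c n u = 0) /\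
  (tau 0%N <= u -> u < tau n ->
    exists i, [/\ (i < n)%N, tau i <= u < tau i.+1 & step tau c n u = c i]).
Proof.
elim: n => [|n IH] ndtau.
  split; first by rewrite /step big_ord0.
  by move=> h1 h2; have := le_lt_trans h1 h2; rewrite ltxx.
have [|IH1 IH2] := IH; first by move=> i i_n; apply: ndtau; rewrite ltnW.
have nn := ndtau n (ltnSn _).
have E : step tau c n.+1 u =
    step tau c n u + c n * (u \in `[tau n, tau n.+1[%classic)%:R.
  by rewrite /step big_ord_recr/= indicE.
rewrite E; split => [nu|u0 un].
  by rewrite IH1 ?(le_trans nn)// memNset ?mulr0 ?addr0//= in_itv/= ltNge nu andbF.
have [nu|nu] := leP (tau n) u.
  exists n; split => //; first by rewrite nu un.
  by rewrite IH1// mem_set ?mulr1 ?add0r//= in_itv/= nu un.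
have [i [i_n iu ->]] := IH2 u0 nu; exists i; split => //; first exact: ltnW.
by rewrite memNset ?mulr0 ?addr0//= in_itv/= leNgt nu.
Qed.

(** A single grid passes through [s] and [t], so that the approximations up to [s] and up to [t]
    differ by a sum over [[s, t]]. Steps of [del] are capped at [s], then at [t]; capped points
    repeat. *)
Lemma refining_grid (s t del : R) : 0 <= s -> s <= t -> 0 < del ->
  exists tau : nat -> R, exists m n, [/\ (m <= n)%N,
    tau 0%N = 0, tau m = s, tau n = t &
    forall i, tau i <= tau i.+1 <= tau i + del].
Proof.
move=> s0 st del0.
have [m hm] : exists m : nat, s <= m%:R * del.
  exists (Num.truncn (s / del)).+1; rewrite -ler_pdivrMr//.
  by apply/ltW/truncnS_gt.
have [k hk] : exists k : nat, t - s <= k%:R * del.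
  exists (Num.truncn ((t - s) / del)).+1; rewrite -ler_pdivrMr//.
  by apply/ltW/truncnS_gt.
exists (fun i => if (i <= m)%N then Num.min (i%:R * del) s
                 else Num.min (s + (i - m)%:R * del) t), m, (m + k)%N.
split.
- exact: leq_addr.
- by rewrite leq0n mul0r min_l.
- by rewrite leqnn min_r.
- case: k hk => [|k] hk.
    rewrite addn0 leqnn min_r//; lra.
  by rewrite addnS ltnNge leq_addr/= -addnS addKn min_r//; lra.
move=> i; have [im|mi] := ltnP i m.
  rewrite (ltnW im) -natr1 mulrDl mul1r.
  by have [] := leP (i%:R * del) s; have [] := leP (i%:R * del + del) s; lra.
have [im|im] := eqVneq i m.
  rewrite im leqnn subSnn mul1r (min_r hm).
  by have [] := leP (s + del) t; lra.
rewrite leqNgt ltn_neqAle eq_sym im mi/=.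
rewrite subSn// -natr1 mulrDl mul1r.
have [] := leP (s + (i - m)%:R * del) t;
  have [] := leP (s + ((i - m)%:R * del + del)) t; lra.
Qed.

End step_functions.

(** * Increments of the stochastic integral *)

Lemma step_function_l2 {R : realType} (sigma : R -> R) (tau : nat -> R) n
    (t eta : R) :
  {within `[0, +oo[, continuous sigma} ->
  tau 0%N = 0 -> tau n = t -> (forall i, (i < n)%N -> tau i <= tau i.+1) ->
  (forall i u, (i < n)%N -> tau i <= u < tau i.+1 ->
    `|sigma (tau i) - sigma u| <= eta) ->
  0 <= t ->
  (\int[lebesgue_measure]_(u in `[0%R, t])
    ((\sum_(i < n) sigma (tau i) * \1_(`[tau i, tau i.+1[%classic) u
      - sigma u) ^+ 2)%:E <= (eta ^+ 2 * t)%:E)%E.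
Proof.
move=> csigma tau0 taun ndtau Heta t0.
set h := fun u => ((\sum_(i < n) sigma (tau i) * \1_(`[tau i, tau i.+1[%classic) u
      - sigma u) ^+ 2).
have msigma : measurable_fun (`[0%R, t[%classic : set R) sigma.
  apply: (@measurable_funS _ _ _ _ (`[0%R, +oo[%classic : set R)) => //.
    by apply: subset_itvl.
  exact: subspace_continuous_measurable_fun.
have mh : measurable_fun (`[0%R, t[%classic : set R) (EFin \o h).
  apply/measurable_EFinP; apply: (@measurable_funX _ _ _ _ (fun u => _ - sigma u)).
  apply: measurable_funB => //.
  apply: measurable_sum => i; apply: measurable_funM; first exact: measurable_cst.
  apply: measurable_funTS; exact: measurable_indic.
(* At [u = t] the step function is [0], not close to [sigma t]; dropping this point does not change
   the integral. *)
rewrite -(integral_itv_bndo_bndc (f := EFin \o h))//.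
apply: (@le_trans _ _ (\int[lebesgue_measure]_(u in `[0%R, t[) (eta ^+ 2)%:E)%E).
  apply: ge0_le_integral => //=.
  - by move=> u _; rewrite lee_fin sqr_ge0.
  - move=> u; rewrite in_itv/= => /andP[u0 ut]; rewrite lee_fin /h.
    have [_] := step_valE (fun i => sigma (tau i)) u ndtau.
    rewrite tau0 taun => /(_ u0 ut) [i [i_n iu ->]].
    rewrite -real_normK ?num_real//.
    by rewrite lerXn2r ?nnegrE ?(le_trans _ (Heta i u _ _))// Heta.
rewrite integral_cst//= lebesgue_measure_itv/= lte_fin.
have [h0|h0] := ltP 0 t; first by rewrite sube0 -EFinM.
by rewrite mule0 lee_fin mulr_ge0 ?sqr_ge0.
Qed.

Section ito_increments.
Context {R : realType} {d : measure_display} {T : measurableType d}.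
Variables (P : probability T R) (F : R -> set (set T)) (B : R -> T -> R).
Variables (sigma : R -> R) (I : R -> T -> R).
Hypothesis hF : filtration F.
Hypothesis hB : brownian_motion P F B.
Hypothesis csigma : {within `[0, +oo[, continuous sigma}.
Hypothesis hI : ito_integral P F B (fun s _ => sigma s) I.

Let sF t : 0 <= t -> sigma_algebra setT (F t). Proof. by case: hF => + _ _; apply. Qed.
Let mF t : 0 <= t -> F t `<=` measurable. Proof. by case: hF => _ + _; apply. Qed.

Lemma process_measurable (X : R -> T -> R) t : continuous_adapted F X -> 0 <= t ->
  measurable_fun setT (X t).
Proof. by move=> [_ FX] t0; exact: (measurable_wrt_fun (mF t0) (FX _ t0)). Qed.

Lemma chebyshev_sqr (Z : T -> R) (e k : R) : measurable_fun setT Z -> 0 < e ->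
  (\int[P]_w ((Z w) ^+ 2)%:E < k%:E)%E ->
  measurable [set w | e < `|Z w|] /\ pr P [set w | e < `|Z w|] <= k / e ^+ 2.
Proof.
move=> mZ e0 Zk; have mN : measurable [set w | e < `|Z w|].
  by apply: (@gtr_measurable _ _ _ (fun w => `|Z w|)); exact: measurableT_comp.
split => //; rewrite ler_pdivlMr ?exprn_gt0// mulrC -lee_fin EFinM -prE//.
apply: le_trans (ltW Zk); rewrite -(integral_cst P mN).
have mZ2 : measurable_fun setT (fun w => ((Z w) ^+ 2)%:E).
  by apply/measurable_EFinP; exact: measurable_funX.
apply: (@le_trans _ _ (\int[P]_(w in [set w | e < `|Z w|]%R) ((Z w) ^+ 2)%:E)%E).
  apply: ge0_le_integral => //=.
  - by move=> w _; rewrite lee_fin sqr_ge0.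
  - exact: measurable_funTS.
  - move=> w eZ; rewrite lee_fin -[leRHS]real_normK ?num_real//.
    by rewrite lerXn2r ?nnegrE// ltW.
by apply: ge0_subset_integral => // w _; rewrite lee_fin sqr_ge0.
Qed.

(** As [sigma] is deterministic, the inner integral is the same number on every path; its
    expectation is that number, at most [eta ^+ 2 * t]. *)
Let approx (tau : nat -> R) n t (eta del : R) :
  0 <= t -> (forall i, (i < n)%N -> tau i <= tau i.+1) ->
  (forall i u, (i < n)%N -> tau i <= u < tau i.+1 ->
    `|sigma (tau i) - sigma u| <= eta) ->
  tau 0%N = 0 -> tau n = t -> eta ^+ 2 * t < del ->
  forall e : R,
  (forall phi : elementary F t,
      (\int[P]_w \int[lebesgue_measure]_(s in `[0%R, t])
          ((elementary_val phi s w - sigma s) ^+ 2)%:E < del%:E)%E ->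
      (\int[P]_w ((elementary_int B phi w - I t w) ^+ 2)%:E < e%:E)%E) ->
  (\int[P]_w ((\sum_(0 <= i < n) sigma (tau i) * (B (tau i.+1) w - B (tau i) w)
    - I t w) ^+ 2)%:E < e%:E)%E.
Proof.
move=> t0 ndtau Heta tau0 taun del0 e hphi.
have tau_ge0 i : (i <= n)%N -> 0 <= tau i.
  elim: i => [|i IH] i_n; first by rewrite tau0.
  by apply: le_trans (ndtau i i_n); apply: IH; exact: ltnW.
have cm i : (i < n)%N -> measurable_wrt (F (tau i)) (fun _ : T => sigma (tau i)).
  move=> i_n; apply: (measurable_wrt_cst (sF _)); apply: tau_ge0; exact: ltnW.
have cb i : (i < n)%N -> exists M, forall w : T, `|sigma (tau i)| <= M.
  by move=> _; exists `|sigma (tau i)|.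
pose phi : elementary F t :=
  @Elementary _ _ _ F t n tau (fun i _ => sigma (tau i)) tau0 taun ndtau cm cb.
have := hphi phi; rewrite /elementary_int /= => H.
under eq_integral do rewrite big_mkord.
apply: H.
have := step_function_l2 csigma tau0 taun ndtau Heta t0.
set k := (\int[lebesgue_measure]_(s in _) _)%E => kle.
apply: (@le_lt_trans _ _ (\int[P]_w (cst k w))%E); first by [].
have -> : (\int[P]_w (cst k w) = k)%E.
  rewrite integral_cst//; transitivity (k * 1)%E; last by rewrite mule1.
  by congr (_ * _)%E; exact: probability_setT.
apply: le_lt_trans kle _.
by rewrite lte_fin.
Qed.

Lemma ito_incr_prob_limit s t : 0 <= s -> s <= t ->
  prob_limit P (indep_sym P (F s)) (fun w => I t w - I s w).
Proof.
move=> s0 st e eta e0 eta0; have t0 := le_trans s0 st.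
have [cI hI2] := hI.
(* By Chebyshev's inequality at level [e / 2], a mean square error below [eps] leaves probability at
   most [eta / 2]. *)
pose eps := (e / 2) ^+ 2 * (eta / 2).
have eps0 : 0 < eps by rewrite mulr_gt0 ?exprn_gt0//; lra.
have epsE : eps / (e / 2) ^+ 2 = eta / 2.
  by rewrite /eps mulrAC divff ?mul1r// expf_neq0// gt_eqF//; lra.
have [del1 del10 H1] := hI2 s s0 _ eps0.
have [del2 del20 H2] := hI2 t t0 _ eps0.
pose del := Num.min del1 del2.
have del0 : 0 < del by rewrite lt_min del10.
(* From [h <= 1] and [h * (t + 1) <= del] follows [h ^+ 2 * t <= h * t < del]. *)
pose h := Num.min 1 (del / (t + 1)).
have h0 : 0 < h by rewrite lt_min ltr01 divr_gt0//; lra.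
have ht : h ^+ 2 * t < del.
  have h1 : h <= 1 by rewrite ge_min lexx.
  have h2 : h * (t + 1) <= del.
    by rewrite -ler_pdivlMr; [rewrite ge_min lexx orbT|lra].
  by nra.
have [r r0 Hr] := unif_continuous_segment 0 t (continuous_max0 csigma) h0.
have [tau [m [n [mn tau0 taum taun Htau]]]] := refining_grid s0 st
  (ltac:(lra) : 0 < r / 2).
have ndtau i : tau i <= tau i.+1 by case/andP: (Htau i).
have tau_nd : {homo tau : i j / (i <= j)%N >-> i <= j}.
  by apply: homo_leq => //; exact: le_trans.
have tau_ge0 i : 0 <= tau i by rewrite -tau0 tau_nd.
have Hmesh i u : (i < n)%N -> tau i <= u < tau i.+1 ->
    `|sigma (tau i) - sigma u| <= h.
  move=> i_n /andP[iu ui].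
  have := Hr (tau i) u; rewrite !max_r ?(le_trans (tau_ge0 i) iu)// => H.
  apply/ltW/H; first by rewrite tau_ge0 -taun tau_nd// ltnW.
  rewrite ler0_norm ?subr_le0//; case/andP: (Htau i); lra.
pose S k w := \sum_(0 <= i < k) sigma (tau i) * (B (tau i.+1) w - B (tau i) w).
have mS k : measurable_fun setT (S k).
  have := @brownian_sum_indep_sym _ _ _ _ _ _ hF hB tau
    (fun i => sigma (tau i)) 0 k tau_ge0 (fun i _ => ndtau i) (leq0n k).
  by move=> [[]].
have [mN1 pN1] : measurable [set w | e / 2 < `|S m w - I s w|] /\
    pr P [set w | e / 2 < `|S m w - I s w|] <= eta / 2.
  have := @chebyshev_sqr (fun w => S m w - I s w) (e / 2) eps.
  rewrite epsE.
  apply; [|by lra|].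
    by apply: measurable_funB => //; exact: (process_measurable cI).
  apply: (approx s0 _ _ tau0 taum _ H1) => //.
  - by move=> i u im; apply: Hmesh; exact: leq_trans mn.
  - apply: (le_lt_trans _ (lt_le_trans ht (_ : del <= del1))).
      by rewrite ler_wpM2l ?sqr_ge0.
    by rewrite ge_min lexx.
have [mN2 pN2] : measurable [set w | e / 2 < `|S n w - I t w|] /\
    pr P [set w | e / 2 < `|S n w - I t w|] <= eta / 2.
  have := @chebyshev_sqr (fun w => S n w - I t w) (e / 2) eps.
  rewrite epsE.
  apply; [|by lra|].
    by apply: measurable_funB => //; exact: (process_measurable cI).
  apply: (approx t0 _ Hmesh tau0 taun _ H2) => //.
  by apply: (lt_le_trans ht); rewrite ge_min lexx orbT.
exists (fun w => \sum_(m <= i < n) sigma (tau i) * (B (tau i.+1) w - B (tau i) w)).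
  have [] := @brownian_sum_indep_sym _ _ _ _ _ _ hF hB tau
    (fun i => sigma (tau i)) m n tau_ge0 (fun i _ => ndtau i) mn.
  by rewrite taum.
exists ([set w | e / 2 < `|S m w - I s w|] `|` [set w | e / 2 < `|S n w - I t w|]).
  split; first exact: measurableU.
  by apply: le_trans (prU_le P mN1 mN2) _; lra.
move=> w /not_orP[/negP + /negP]; rewrite -!leNgt => h1 h2.
have -> : \sum_(m <= i < n) sigma (tau i) * (B (tau i.+1) w - B (tau i) w) =
    S n w - S m w.
  by rewrite /S [X in _ = X - _](big_cat_nat (leq0n m) mn)/= addrAC subrr add0r.
rewrite (_ : _ - _ = (S n w - I t w) - (S m w - I s w)); last by ring.
by apply: le_trans (ler_normB _ _) _; lra.
Qed.

Lemma ito_incr_indep s t A c : 0 <= s -> s <= t -> F s A ->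
  pr P (A `&` [set w | c < I t w - I s w]) =
  pr P A * pr P [set w | c < I t w - I s w].
Proof.
move=> s0 st FA; have [cI _] := hI.
apply: (prob_limit_indep _ (mF s0) FA _ (ito_incr_prob_limit s0 st)).
by apply: measurable_funB; apply: (process_measurable cI) => //; exact: le_trans st.
Qed.

Lemma ito_incr_sym s t c : 0 <= s -> s <= t ->
  pr P [set w | c < - (I t w - I s w)] = pr P [set w | c < I t w - I s w].
Proof.
move=> s0 st; have [cI _] := hI.
apply: (prob_limit_sym _ (mF s0) _ (ito_incr_prob_limit s0 st)).
by apply: measurable_funB; apply: (process_measurable cI) => //; exact: le_trans st.
Qed.

Lemma ito_incr_indepN s t A c : 0 <= s -> s <= t -> F s A ->
  pr P (A `&` [set w | c < - (I t w - I s w)]) =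
  pr P A * pr P [set w | c < - (I t w - I s w)].
Proof.
move=> s0 st FA; have [cI _] := hI.
apply: (prob_limit_indep _ (mF s0) FA _ (prob_limitN (ito_incr_prob_limit s0 st))).
by apply: measurable_funN; apply: measurable_funB;
  apply: (process_measurable cI) => //; exact: le_trans st.
Qed.

End ito_increments.

(** * Levy's maximal inequality *)

Section levy_inequality.
Context {R : realType} {d : measure_display} {T : measurableType d}.
Variables (P : probability T R) (F : R -> set (set T)).
Hypothesis hF : filtration F.
Notation pr := (pr P).

Definition sym_indep_incr (M : R -> T -> R) := forall s t, 0 <= s -> s <= t ->
  [/\ forall A c, F s A -> pr (A `&` [set w | c < M t w - M s w]) =
        pr A * pr [set w | c < M t w - M s w],
      forall A c, F s A -> pr (A `&` [set w | c < - (M t w - M s w)]) =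
        pr A * pr [set w | c < - (M t w - M s w)]
    & forall c, pr [set w | c < - (M t w - M s w)] =
        pr [set w | c < M t w - M s w]].

Lemma sym_indep_incrN M : sym_indep_incr M ->
  sym_indep_incr (fun t w => - M t w).
Proof.
move=> HM s t s0 st; have [h1 h2 h3] := HM s t s0 st.
have e1 c : [set w | c < - M t w - - M s w] = [set w | c < - (M t w - M s w)].
  by apply/seteqP; split => w /=; rewrite opprB opprK addrC.
have e2 c : [set w | c < - (- M t w - - M s w)] = [set w | c < M t w - M s w].
  by apply/seteqP; split => w /=; rewrite opprD !opprK.
by split => [A c FA|A c FA|c]; rewrite ?e1 ?e2 ?h1 ?h2 ?h3.
Qed.

Lemma continuous_adaptedN M : continuous_adapted F M ->
  continuous_adapted F (fun t w => - M t w).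
Proof.
move=> [cM FM]; split => [w|t t0].
  by move=> x; apply: (@continuousN _ _ (subspace _)); exact: cM.
by apply: measurable_wrtN; [case: hF => + _ _; apply|exact: FM].
Qed.

Let sF t : 0 <= t -> sigma_algebra setT (F t). Proof. by case: hF => + _ _; apply. Qed.
Let mF t : 0 <= t -> F t `<=` measurable. Proof. by case: hF => _ + _; apply. Qed.
Let ndF s t : 0 <= s -> s <= t -> F s `<=` F t. Proof. by case: hF => _ _; apply. Qed.

Variable M : R -> T -> R.
Hypothesis cM : continuous_adapted F M.
Hypothesis hM : sym_indep_incr M.

Let mM t : 0 <= t -> measurable_fun setT (M t).
Proof. by move=> t0; exact: (process_measurable hF cM). Qed.

Lemma incr_event s t c : 0 <= s -> s <= t -> F t [set w | c < M t w - M s w].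
Proof.
move=> s0 st; have t0 := le_trans s0 st; have [_ FM] := cM.
have : measurable_wrt (F t) (fun w => M t w - M s w).
  apply: (measurable_wrtB (sF t0) (FM _ t0)).
  by apply: measurable_wrtS (FM _ s0); exact: ndF.
move=> /(_ `]c, +oo[%classic (measurable_itv _)); congr (F t _).
by apply/seteqP; split => w /=; rewrite in_itv/= andbT.
Qed.

(** Symmetry makes a negative increment have probability at most 1/2, and independence keeps this
    bound on [A]. *)
Lemma incr_half s t A : 0 <= s -> s <= t -> F s A ->
  pr A <= 2 * pr (A `&` [set w | 0 <= M t w - M s w]).
Proof.
move=> s0 st FA; have t0 := le_trans s0 st.
have [_ hi hs] := hM s0 st.
have mD : measurable_fun setT (fun w => M t w - M s w).
  by apply: measurable_funB; exact: mM.
have mA : measurable A by exact: (mF s0).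
have mp : measurable [set w | 0 < M t w - M s w] by exact: gtr_measurable.
have mn : measurable [set w | 0 < - (M t w - M s w)].
  by apply: gtr_measurable; exact: measurable_funN.
have eC : [set w | 0 <= M t w - M s w] = ~` [set w | 0 < - (M t w - M s w)].
  by apply/seteqP; split => w /=; rewrite oppr_gt0 leNgt => /negP.
have mC : measurable [set w | 0 <= M t w - M s w].
  by rewrite eC; exact: measurableC.
rewrite (prID P mA mC) (_ : A `\` _ = A `&` [set w | 0 < - (M t w - M s w)]);
  last by rewrite eC setDE setCK.
rewrite (hi _ _ FA).
have q2 : pr [set w | 0 < - (M t w - M s w)] <= 2^-1.
  have : pr [set w | 0 < - (M t w - M s w)] <=
      pr (~` [set w | 0 < M t w - M s w]).
    apply: le_pr => //; first exact: measurableC.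
    by move=> w /=; rewrite oppr_gt0 => h /lt_trans => /(_ _ h); rewrite ltxx.
  rewrite prC// -hs; lra.
have : pr A = pr (A `&` [set w | 0 <= M t w - M s w]) +
   pr A * pr [set w | 0 < - (M t w - M s w)].
  rewrite -(hi _ _ FA) [LHS](prID P mA mC); congr (_ + pr _).
  by rewrite eC setDE setCK.
have := pr_ge0 P A; nra.
Qed.

Let hit (u : nat -> R) lam k :=
  [set w | exists2 j, (j <= k)%N & lam < M (u j) w - M (u 0%N) w].

Let hitS u lam k : hit u lam k.+1 =
  hit u lam k `|` [set w | lam < M (u k.+1) w - M (u 0%N) w].
Proof.
apply/seteqP; split => w /=.
  by move=> [j]; rewrite leq_eqVlt ltnS => /predU1P[->|jk] h; [right|left; exists j].
by move=> [[j jk h]|h]; [exists j => //; exact: leqW|exists k.+1].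
Qed.

Let hit_event u lam k : 0 <= u 0%N -> (forall i, u i <= u i.+1) ->
  F (u k) (hit u lam k).
Proof.
move=> u0 ndu; have u_nd : {homo u : i j / (i <= j)%N >-> i <= j}.
  by apply: homo_leq => //; exact: le_trans.
elim: k => [|k IH].
  rewrite (_ : hit _ _ _ = [set w | lam < M (u 0%N) w - M (u 0%N) w]).
    exact: incr_event.
  apply/seteqP; split => w /=; last by move=> h; exists 0%N.
  by move=> [j]; rewrite leqn0 => /eqP ->.
have uk0 : 0 <= u k by apply: le_trans (u_nd 0%N k _).
rewrite hitS; apply: (sub_sigma_algebraU (sF (le_trans uk0 (ndu k)))).
  exact: (ndF uk0 (ndu k)).
by apply: incr_event => //; exact: u_nd.
Qed.

Let levy_discrete (u : nat -> R) lam n A : 0 <= u 0%N ->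
  (forall i, u i <= u i.+1) -> F (u 0%N) A ->
  pr (A `&` hit u lam n) <= 2 * pr (A `&` [set w | lam < M (u n) w - M (u 0%N) w]).
Proof.
move=> u0 ndu FA; have u_nd : {homo u : i j / (i <= j)%N >-> i <= j}.
  by apply: homo_leq => //; exact: le_trans.
have u_ge0 k : 0 <= u k by apply: le_trans (u_nd 0%N k _).
have mA : measurable A by exact: (mF u0).
set L := [set w | lam < M (u n) w - M (u 0%N) w].
have mL : measurable L.
  by apply: (mF (u_ge0 n)); apply: incr_event => //; exact: u_nd.
have mH k : measurable (hit u lam k) by apply: (mF (u_ge0 k)); exact: hit_event.
(* On the event that level [lam] is first exceeded at time [u k], the later
   increment is nonnegative with conditional probability at least 1/2. *)
have step k A' : (k <= n)%N -> F (u k) A' ->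
    A' `<=` [set w | lam < M (u k) w - M (u 0%N) w] -> pr A' <= 2 * pr (A' `&` L).
  move=> kn FA' A'sub; apply: le_trans (incr_half (u_ge0 k) (u_nd _ _ kn) FA') _.
  rewrite ler_pM2l//; have mA' := mF (u_ge0 k) FA'.
  apply: le_pr; last 1 first.
  - move=> w [A'w /= h]; split => //; have := A'sub _ A'w; rewrite /L /=; lra.
  - apply: measurableI => //.
    rewrite (_ : [set w | _] = ~` [set w | 0 < - (M (u n) w - M (u k) w)]).
      apply: measurableC; apply: gtr_measurable; apply: measurable_funN.
      by apply: measurable_funB; exact: mM.
    by apply/seteqP; split => w /=; rewrite oppr_gt0 leNgt => /negP.
  - exact: measurableI.
(* Keeping [hit u lam k] on the right makes the inequality additive over the disjoint events of a
   first hit. *)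
suff H k : (k <= n)%N -> pr (A `&` hit u lam k) <= 2 * pr (A `&` hit u lam k `&` L).
  apply: le_trans (H n (leqnn _)) _; rewrite ler_pM2l//.
  apply: le_pr; [by apply: measurableI => //; exact: measurableI|exact: measurableI|].
  by move=> w [[]].
elim: k => [|k IH] kn.
  apply: (step 0%N) => //.
    apply: (sub_sigma_algebraI (sF u0)) => //; exact: hit_event.
  by move=> w [_ [j]]; rewrite leqn0 => /eqP ->.
(* The part of [A] where [lam] is first exceeded at index [k.+1]; both sides split along
   [hit u lam k]. *)
pose A' := (A `&` [set w | lam < M (u k.+1) w - M (u 0%N) w]) `\` hit u lam k.
have FA' : F (u k.+1) A'.
  apply: (sub_sigma_algebraI (sF (u_ge0 _))).
    apply: (sub_sigma_algebraI (sF (u_ge0 _))).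
      exact: (ndF u0 (u_nd 0%N _ _)).
    by apply: incr_event => //; exact: u_nd.
  apply: (sub_sigma_algebraC (sF (u_ge0 _))).
  by apply: (ndF (u_ge0 k) (ndu k)); exact: hit_event.
have A'sub : A' `<=` [set w | lam < M (u k.+1) w - M (u 0%N) w] by move=> w [[]].
have mA' := mF (u_ge0 _) FA'.
have h1 := step _ _ kn FA' A'sub; have h2 := IH (ltnW kn).
rewrite (prID P (measurableI _ _ mA (mH k.+1)) (mH k)).
rewrite (prID P (measurableI _ _ (measurableI _ _ mA (mH k.+1)) mL) (mH k)).
have e1 : A `&` hit u lam k.+1 `&` hit u lam k = A `&` hit u lam k.
  rewrite hitS; apply/seteqP; split => w; first by move=> [[]].
  by move=> [Aw h]; split=> //; split=> //; left.
have e2 : A `&` hit u lam k.+1 `\` hit u lam k = A'.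
  rewrite hitS /A'; apply/seteqP; split => w.
    by move=> [[Aw [//|h]] nh].
  by move=> [[Aw h] nh]; split=> //; split=> //; right.
have e3 : A `&` hit u lam k.+1 `&` L `&` hit u lam k = A `&` hit u lam k `&` L.
  by rewrite setIAC e1.
have e4 : A `&` hit u lam k.+1 `&` L `\` hit u lam k = A' `&` L.
  by rewrite -e2 !setDE setIAC.
by rewrite e1 e2 e3 e4 mulrDr lerD.
Qed.

Definition exceeds s t lam := [set w | exists2 u, s <= u <= t & lam < M u w - M s w].

(** Frozen at [t] from index [2 ^ m] on, since [levy_discrete] takes an infinite nondecreasing
    sequence. *)
Let dyadic (s t : R) m j := s + (t - s) * Num.min 1 (j%:R / 2 ^+ m).

Let dyadic0 s t m : dyadic s t m 0%N = s.
Proof. by rewrite /dyadic mul0r min_r ?mulr0 ?addr0. Qed.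

Let dyadic1 s t m : dyadic s t m (2 ^ m)%N = t.
Proof.
by rewrite /dyadic natrX divff ?expf_neq0// minxx mulr1 addrC subrK.
Qed.

(** By continuity a strict exceedance at [u] persists nearby, hence at the last dyadic point up to
    [u] of a fine enough grid. *)
Let exceedsE s t lam : 0 <= s -> s <= t ->
  exceeds s t lam = \bigcup_m hit (dyadic s t m) lam (2 ^ m)%N.
Proof.
move=> s0 st.
apply/seteqP; split => w /=; last first.
  move=> [m _ [j jm]]; rewrite dyadic0 => h; exists (dyadic s t m j) => //.
  have : 0 <= Num.min (1 : R) (j%:R / 2 ^+ m) <= 1.
    by rewrite ge_min lexx le_min ler01 divr_ge0// exprn_ge0.
  by rewrite /dyadic => /andP[h1 h2]; apply/andP; split; nra.
move=> [u /andP[su ut]]; rewrite -subr_gt0 => h.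
have [cMw _] := cM; have cMx := continuous_max0 (cMw w).
have := cMx u => /cvgrPdist_lt /(_ _ h) [r /= r0 rP].
have [ts|ts] := leP (t - s) 0.
  exists 0%N => //; exists 0%N => //; rewrite dyadic0.
  have us : u = s by lra.
  by move: h; rewrite us; lra.
have [m hm] : exists m, (t - s) / r < (2 ^ m)%:R.
  exists (Num.truncn ((t - s) / r)).+1.
  apply: lt_le_trans (truncnS_gt _) _; rewrite ler_nat.
  exact/ltnW/ltn_expl.
exists m => //.
pose x := (u - s) / (t - s) * 2 ^+ m.
have p2 : 0 < 2 ^+ m :> R by rewrite exprn_gt0.
have x0 : 0 <= x by rewrite mulr_ge0 ?divr_ge0 ?(ltW p2) ?subr_ge0// ltW.
pose j := Num.truncn x.
have /andP[jx xj] := truncn_itv x0.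
have x1 : x <= 2 ^+ m.
  by rewrite /x ler_piMl ?(ltW p2)// ler_pdivrMr// mul1r; lra.
have jm : (j <= 2 ^ m)%N.
  by rewrite -(ler_nat R) natrX; apply: le_trans jx _.
exists j => //; rewrite dyadic0.
have j1 : j%:R / 2 ^+ m <= 1 :> R.
  by rewrite ler_pdivrMr// mul1r; apply: le_trans jx _.
have uE : u = s + (t - s) * (x / 2 ^+ m).
  rewrite /x mulfK ?gt_eqF// mulrC divfK ?gt_eqF//; lra.
have jd : 0 <= u - dyadic s t m j < r.
  rewrite /dyadic min_r// uE opprD addrACA subrr add0r -mulrBr -mulrBl.
  rewrite mulr_ge0 ?(ltW ts)//=; last by rewrite divr_ge0 ?subr_ge0 ?(ltW p2).
  move: hm; rewrite natrX ltr_pdivrMr// => hm.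
  rewrite mulrA ltr_pdivrMr// [ltRHS]mulrC; apply: le_lt_trans _ hm.
  by rewrite ler_piMr ?(ltW ts)//; move: xj; rewrite -natr1; lra.
have sj : s <= dyadic s t m j.
  by rewrite /dyadic lerDl mulr_ge0 ?(ltW ts)// min_r// divr_ge0// ltW.
have := rP (dyadic s t m j); rewrite /= !max_r; [|lra|lra].
rewrite ger0_norm; last by case/andP: jd.
case/andP: jd => _ jd /(_ jd); rewrite ltr_norml => /andP[_ h2]; lra.
Qed.

Let dyadic_nd s t m : s <= t -> forall i, dyadic s t m i <= dyadic s t m i.+1.
Proof.
move=> st i; rewrite lerD2l ler_wpM2l ?subr_ge0//.
have : i%:R / 2 ^+ m <= i.+1%:R / 2 ^+ m :> R.
  by rewrite ler_wpM2r ?invr_ge0 ?exprn_ge0// ler_nat.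
by rewrite le_min !ge_min lexx /= => ->; rewrite orbT.
Qed.

Let hit_dyadic_nd s t lam :
  nondecreasing_seq (fun m => hit (dyadic s t m) lam (2 ^ m)%N).
Proof.
apply/nondecreasing_seqP => m; apply/subsetPset => w [j jm h].
have dE i : dyadic s t m i = dyadic s t m.+1 (2 * i)%N.
  by rewrite /dyadic exprS natrM invfM mulrACA divff ?mul1r// pnatr_eq0.
exists (2 * j)%N; first by rewrite expnS leq_mul2l.
by rewrite -dE (_ : dyadic s t m.+1 0%N = dyadic s t m 0%N)// dE muln0.
Qed.

Lemma exceeds_event s t lam : 0 <= s -> s <= t -> F t (exceeds s t lam).
Proof.
move=> s0 st; rewrite exceedsE//.
apply: (sub_sigma_algebra_bigcup (sF (le_trans s0 st))) => m.
rewrite -{1}(dyadic1 s t m); apply: hit_event; first by rewrite dyadic0.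
exact: dyadic_nd.
Qed.

Lemma levy s t lam A : 0 <= s -> s <= t -> F s A ->
  pr (A `&` exceeds s t lam) <= 2 * pr (A `&` [set w | lam < M t w - M s w]).
Proof.
move=> s0 st FA; rewrite exceedsE// setI_bigcupr; have t0 := le_trans s0 st.
have mA := mF s0 FA.
have mH m : measurable (hit (dyadic s t m) lam (2 ^ m)%N).
  apply: (mF t0); rewrite -{1}(dyadic1 s t m); apply: hit_event.
    by rewrite dyadic0.
  exact: dyadic_nd.
apply: pr_bigcup_le => [m|m n mn|m].
- exact: measurableI.
- apply/subsetPset; apply: setIS; apply/subsetPset.
  exact: (@hit_dyadic_nd s t lam _ _ mn).
- have := @levy_discrete (dyadic s t m) lam (2 ^ m)%N A.
  by rewrite dyadic0 dyadic1; apply => //; exact: dyadic_nd.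
Qed.

End levy_inequality.

(** * Paths bounded on one side *)

Lemma bigcap_setI T (A : set T) (E : (set T)^nat) :
  \bigcap_n (A `&` E n) = A `&` \bigcap_n E n.
Proof.
apply/seteqP; split=> [w h|w [Aw h] n _]; last by split => //; exact: h.
by split; [have [] := h 0%N Logic.I|move=> n _; have [] := h n Logic.I].
Qed.

Lemma continuous_path_bounded {R : realType} (h : R -> R) (a b : R) :
  {within `[0, +oo[, continuous h} -> 0 <= a ->
  exists2 K : R, 0 <= K & forall u, a <= u <= b -> `|h u| <= K.
Proof.
move=> /continuous_max0 ch a0; have [ab|ba] := leP a b; last first.
  by exists 0 => // u; lra.
have [|c cab Hc] := @EVT_max R (fun t => `|h (Num.max 0 t)|) a b ab.
  apply: continuous_subspaceT => x; apply: continuous_comp; first exact: ch.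
  exact: norm_continuous.
exists `|h (Num.max 0 c)| => // u /andP[au ub].
by rewrite -[u in leLHS](@max_r _ _ 0 u) ?Hc ?in_itv/= ?au//; exact: le_trans au.
Qed.

Section dichotomy.
Context {R : realType} {d : measure_display} {T : measurableType d}.
Variables (P : probability T R) (F : R -> set (set T)).
Hypothesis hF : filtration F.
Notation pr := (pr P).

Let ever_exceeds (M : R -> T -> R) s lam :=
  \bigcup_n exceeds M s (s + n%:R) lam.

Let unbounded M s := \bigcap_n ever_exceeds M s n%:R.

Let mF t : 0 <= t -> F t `<=` measurable. Proof. by case: hF => _ + _; apply. Qed.

Let exceeds_sub M s t lam : s <= t -> exceeds M s t lam `<=` ever_exceeds M s lam.
Proof.
move=> st w [u /andP[su ut] h]; exists (Num.truncn (t - s)).+1 => //.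
exists u => //; rewrite su/=; apply: le_trans ut _.
by rewrite -lerBlDl ltW// truncnS_gt.
Qed.

Let ever_exceedsP M s lam w :
  ever_exceeds M s lam w <-> exists2 u, s <= u & lam < M u w - M s w.
Proof.
split; first by move=> [n _ [u /andP[su _] h]]; exists u.
by move=> [u su h]; apply: (exceeds_sub su); exists u => //; rewrite su lexx.
Qed.

Let ever_exceeds_measurable M s lam : continuous_adapted F M -> 0 <= s ->
  measurable (ever_exceeds M s lam).
Proof.
move=> cM s0; apply: bigcup_measurable => n _.
have sn : s <= s + n%:R by rewrite lerDl.
exact: (mF (le_trans s0 sn) (exceeds_event hF cM _ s0 sn)).
Qed.

Let unbounded_measurable M s : continuous_adapted F M -> 0 <= s ->
  measurable (unbounded M s).
Proof. by move=> cM s0; apply: bigcap_measurable => // n _; exact: ever_exceeds_measurable. Qed.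

(** Levy's inequality on [[s, s + n]] bounds the maximum by the final increment. Independence and
    symmetry replace that increment by its opposite, which is an exceedance by [- M]. *)
Let reflection M s lam A : continuous_adapted F M -> sym_indep_incr P F M ->
  0 <= s -> F s A ->
  pr (A `&` ever_exceeds M s lam) <=
  2 * pr (A `&` ever_exceeds (fun t w => - M t w) s lam).
Proof.
move=> cM hM s0 FA; have mA := mF s0 FA.
have cN := continuous_adaptedN hF cM; have hN := sym_indep_incrN hM.
rewrite {1}/ever_exceeds setI_bigcupr.
apply: pr_bigcup_le => [n|m n mn|n].
- have sn : s <= s + n%:R by rewrite lerDl.
  by apply: measurableI => //; exact: (mF (le_trans s0 sn) (exceeds_event hF cM _ s0 sn)).
- apply/subsetPset => w [Aw [u /andP[su um] h]]; split => //; exists u => //.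
  by rewrite su/=; apply: le_trans um _; rewrite lerD2l ler_nat.
have sn : s <= s + n%:R by rewrite lerDl.
have sn0 := le_trans s0 sn.
apply: le_trans (levy hF cM hM lam s0 sn FA) _; rewrite ler_pM2l//.
have [h1 h2 h3] := hM _ _ s0 sn.
rewrite h1// -h3 -h2//; apply: le_pr.
- apply: measurableI => //; apply: gtr_measurable; apply: measurable_funN.
  by apply: measurable_funB; exact: (process_measurable hF cM).
- by apply: measurableI => //; exact: ever_exceeds_measurable.
- apply: setIS => w /= h; apply/ever_exceedsP; exists (s + n%:R) => //.
  by move: h; rewrite opprD opprK.
Qed.

Let unbounded_reflection M s A : continuous_adapted F M -> sym_indep_incr P F M ->
  0 <= s -> F s A ->
  pr (A `&` unbounded M s) <= 2 * pr (A `&` unbounded (fun t w => - M t w) s).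
Proof.
move=> cM hM s0 FA; have mA := mF s0 FA.
have cN := continuous_adaptedN hF cM.
pose E n := A `&` ever_exceeds (fun t w => - M t w) s n%:R.
have mE n : measurable (E n) by apply: measurableI => //; exact: ever_exceeds_measurable.
have niE : nonincreasing_seq E.
  move=> m n mn; apply/subsetPset; apply: setIS => w /ever_exceedsP[u su h].
  by apply/ever_exceedsP; exists u => //; apply: le_lt_trans h; rewrite ler_nat.
have := @pr_bigcap_cvg _ _ _ P _ mE niE.
rewrite /E bigcap_setI => cvgE.
have cvg2 : (2 * pr (E n)) @[n --> \oo] -->
    2 * pr (A `&` unbounded (fun t w => - M t w) s) by exact: cvgMl_tmp.
rewrite -(cvg_lim _ cvg2)//; apply: limr_ge; first by apply/cvg_ex; eexists; exact: cvg2.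
apply: nearW => n; apply: le_trans (reflection _ cM hM s0 FA).
apply: le_pr.
- by apply: measurableI => //; exact: unbounded_measurable.
- by apply: measurableI => //; exact: ever_exceeds_measurable.
- by apply: setIS; exact: bigcap_inf.
Qed.

Let unbounded_shift M (m : R) : continuous_adapted F M -> 0 <= m ->
  unbounded M 0 `<=` unbounded M m.
Proof.
move=> [cM _] m0 w Uw n _.
have [K K0 HK] := continuous_path_bounded m (cM w) (lexx 0).
(* Increments within [[0, m]] are at most [2 * K], so exceeding this level forces [u >= m] and
   leaves more than [n] above [M m]. *)
have [k hk] : exists k : nat, n%:R + 2 * K < k%:R.
  by exists (Num.truncn (n%:R + 2 * K)).+1; exact: truncnS_gt.
have /ever_exceedsP[u u0 hu] := Uw k Logic.I.
have n0 : 0 <= n%:R :> R by [].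
have h1 := HK 0; rewrite lexx m0 in h1; have {h1} := h1 isT.
have h2 := HK m; rewrite lexx m0 in h2; have {h2} := h2 isT.
rewrite !ler_norml => /andP[h1 h2] /andP[h3 h4].
apply/ever_exceedsP; exists u; last by lra.
rewrite leNgt; apply/negP => um; have := HK u; rewrite u0 ltW// => /(_ isT).
by rewrite ler_norml => /andP[h5 h6]; lra.
Qed.

Let unbounded_shift0 M (m : R) : 0 <= m -> unbounded M m `<=` unbounded M 0.
Proof.
move=> m0 w Uw n _.
have [k hk] : exists k : nat, n%:R - M m w + M 0 w < k%:R.
  by exists (Num.truncn (n%:R - M m w + M 0 w)).+1; exact: truncnS_gt.
have /ever_exceedsP[u mu hu] := Uw k Logic.I.
by apply/ever_exceedsP; exists u; [exact: le_trans mu|lra].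
Qed.

Lemma bounded_below_bounded_above M :
  continuous_adapted F M -> sym_indep_incr P F M ->
  P.-negligible [set w | (exists K, forall u, 0 <= u -> K <= M u w) /\
    ~ exists K, forall u, 0 <= u -> M u w <= K].
Proof.
move=> cM hM; pose N t w := - M t w.
have cN : continuous_adapted F N := continuous_adaptedN hF cM.
(* [M] stays at or above [M 0 - k] up to time [m]: an event of the past of [m], to which reflection
   from time [m] applies. *)
pose A k m := ~` exceeds N 0 m%:R k%:R.
have FA k m : F m%:R (A k m).
  have [sF _ _] := hF; apply: (sub_sigma_algebraC (sF _ _)) => //.
  exact: exceeds_event.
have mA k m : measurable (A k m) by exact: (mF _ (FA k m)).
have mU : measurable (unbounded M 0) by exact: unbounded_measurable.
have mV : measurable (unbounded N 0) by exact: unbounded_measurable.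
pose G k := \bigcap_m A k m.
have mG k : measurable (G k) by apply: bigcap_measurable.
have GV k : G k `&` unbounded N 0 = set0.
  rewrite -subset0 => w [Gw Vw].
  have [n _ hn] := Vw k Logic.I.
  by apply: (Gw n Logic.I); rewrite -[n%:R]add0r.
have GU0 k : pr (G k `&` unbounded M 0) = 0.
  apply/eqP; rewrite eq_le pr_ge0 andbT.
  (* [E m] decreases to [G k] intersected with [unbounded N 0], which is empty, and reflection from
     time [m] bounds the left-hand side by [2 * pr (E m)]. *)
  pose E m := A k m `&` unbounded N 0.
  have mE m : measurable (E m) by apply: measurableI => //; exact: mA.
  have niE : nonincreasing_seq E.
    move=> m n mn; apply/subsetPset; apply: setSI => w /= h [u /andP[u0 um] hu]; apply: h.
    by exists u => //; rewrite u0/=; apply: le_trans um _; rewrite ler_nat.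
  have := @pr_bigcap_cvg _ _ _ P _ mE niE; rewrite /E.
  under eq_bigcapr do rewrite setIC.
  rewrite bigcap_setI setIC -/(G k) GV.
  rewrite {2}/pr measure0/= => cvgE.
  have cvg2 : (2 * pr (E n)) @[n --> \oo] --> 2 * (0:R) by exact: cvgMl_tmp.
  have {}cvg2 : (2 * pr (E n)) @[n --> \oo] --> (0:R) by rewrite -[X in _ --> X](mulr0 2).
  rewrite -[leRHS](cvg_lim _ cvg2)//.
  apply: limr_ge; first by apply/cvg_ex; eexists; exact: cvg2.
  apply: nearW => m; have m0 : 0 <= m%:R :> R by [].
  apply: (@le_trans _ _ (pr (A k m `&` unbounded M m%:R))).
    apply: le_pr; first by apply: measurableI => //; exact: mG.
      by apply: measurableI => //; exact: unbounded_measurable.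
    by apply: setISS; [exact: bigcap_inf|exact: unbounded_shift].
  apply: le_trans (unbounded_reflection cM hM m0 (FA k m)) _.
  rewrite ler_pM2l//; apply: le_pr.
  - by apply: measurableI => //; exact: unbounded_measurable.
  - by apply: measurableI => //; exact: mA.
  - by apply: setIS; exact: unbounded_shift0.
apply: (@negligibleS _ _ _ _ (\bigcup_k (G k `&` unbounded M 0))).
  move=> w [[K HK] nU].
  have [k hk] : exists k : nat, M 0 w - K < k%:R.
    by exists (Num.truncn (M 0 w - K)).+1; exact: truncnS_gt.
  exists k => //; split.
    move=> m _ [u /andP[u0 _]]; rewrite /N => h.
    by have := HK u u0; lra.
  move=> n _; apply/ever_exceedsP; apply: contrapT => h; apply: nU.
  exists (n%:R + M 0 w) => u u0; rewrite leNgt; apply/negP => hu; apply: h.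
  by exists u => //; lra.
apply: negligible_bigcup => k; apply/negligibleP; first by apply: measurableI => //; exact: mG.
by apply: (etrans (prE P (measurableI _ _ (mG k) mU))); rewrite GU0.
Qed.

End dichotomy.

(** * Pathwise analysis of the equation *)

Section paths.
Context {R : realType}.
Implicit Types (f i x y : R -> R).

(** The equation with its integral replaced by comparison of the drift with [m * (t - s)]. The form
    is stable under a change of sign, so one-sided estimates serve both sides. *)
Definition drift_path f i x :=
  [/\ {within `[0, +oo[, continuous x}, {within `[0, +oo[, continuous i},
      forall s t m, 0 <= s -> s <= t -> (forall u, s <= u <= t -> m <= f (x u)) ->
        x t - x s <= i t - i s - m * (t - s)
    & forall s t m, 0 <= s -> s <= t -> (forall u, s <= u <= t -> f (x u) <= m) ->
        i t - i s - m * (t - s) <= x t - x s].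

Lemma drift_pathN f i x : drift_path f i x ->
  drift_path (fun v => - f (- v)) (fun t => - i t) (fun t => - x t).
Proof.
move=> [cx ci h1 h2]; split.
- by move=> v; apply: (@continuousN _ _ (subspace _)); exact: cx.
- by move=> v; apply: (@continuousN _ _ (subspace _)); exact: ci.
- move=> s t m s0 st H; have := h2 s t (- m) s0 st.
  have K u : s <= u <= t -> f (x u) <= - m by move=> /H; rewrite opprK; lra.
  by move=> /(_ K); lra.
- move=> s t m s0 st H; have := h1 s t (- m) s0 st.
  have K u : s <= u <= t -> - m <= f (x u) by move=> /H; rewrite opprK; lra.
  by move=> /(_ K); lra.
Qed.

Lemma integral_drift_path f i x (x0 : R) : continuous f ->
  {within `[0, +oo[, continuous x} -> {within `[0, +oo[, continuous i} ->
  (forall t, 0 <= t ->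
    x t = x0 - \int[lebesgue_measure]_(s in `[0, t]) f (x s) + i t) ->
  drift_path f i x.
Proof.
move=> cf cx ci eqx; pose g t := f (x t).
have cg : {within `[0, +oo[, continuous g}.
  by move=> v; apply: (@continuous_comp (subspace _)); [exact: cx|exact: cf].
have ig a b : 0 <= a -> lebesgue_measure.-integrable `[a, b] (EFin \o g).
  move=> a0; apply: continuous_compact_integrable; first exact: segment_compact.
  apply: continuous_subspaceW cg => v; rewrite /= !in_itv/= andbT => /andP[+ _].
  exact: le_trans.
have incr s t : 0 <= s -> s <= t -> x t - x s =
    i t - i s - \int[lebesgue_measure]_(u in `]s, t]) g u.
  move=> s0 st; rewrite (eqx s s0) (eqx t (le_trans s0 st)).
  have := @Rintegral_itvB R g (BLeft 0) (BRight t) s (ig 0 t (lexx 0)).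
  by rewrite !bnd_simp => /(_ s0 st) <-; rewrite /g; ring.
have ioc s t : 0 <= s -> lebesgue_measure.-integrable `]s, t] (EFin \o g).
  by move=> s0; apply: integrableS (ig s t s0) => //; exact: subset_itv_oc_cc.
have icst s t m : lebesgue_measure.-integrable `]s, t] (EFin \o (fun=> m : R)).
  have h : lebesgue_measure.-integrable `[s, t] (EFin \o (fun=> m : R)).
    apply: continuous_compact_integrable; first exact: segment_compact.
    by apply: continuous_subspaceT => v; exact: cvg_cst.
  by apply: integrableS h => //; exact: subset_itv_oc_cc.
have mu s t : s <= t -> fine (lebesgue_measure (`]s, t]%classic : set R)) = t - s.
  move=> st; rewrite lebesgue_measure_itv/= lte_fin.
  by have [//|ts] := ltP s t; rewrite /=; lra.
split => // s t m s0 st H; rewrite incr// lerD2l lerN2 -(mu s t st) -Rintegral_cst//.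
- apply: le_Rintegral => //; first exact: ioc.
  by move=> u /=; rewrite in_itv/= => /andP[su ut]; apply: H; rewrite ltW.
- apply: le_Rintegral => //; first exact: ioc.
  by move=> u /=; rewrite in_itv/= => /andP[su ut]; apply: H; rewrite ltW.
Qed.

(** At the first time [z] reaches [c] the hypothesis yields an earlier time where [c <= z], a
    contradiction. *)
Lemma barrier (z : R -> R) (a b c : R) :
  {within `[0, +oo[, continuous z} -> 0 <= a -> a <= b -> z a < c ->
  (forall t, a < t -> t <= b -> z t = c ->
    exists2 s, a <= s < t & c <= z s) ->
  z b < c.
Proof.
move=> cz a0 ab zac H; rewrite ltNge; apply/negP => cb.
have cg := continuous_max0 cz; set g := fun t : R => z (Num.max 0 t) in cg.
have gz t : a <= t -> g t = z t by move=> at'; rewrite /g max_r// (le_trans a0).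
pose S := `[a, b]%classic `&` [set t | c <= g t].
have cS : compact S.
  apply: (subclosed_compact _ (@segment_compact R a b)); last exact: subIsetl.
  apply: closedI; first exact: interval_closed.
  rewrite (_ : [set t | _] = g @^-1` [set v | c <= v]); last by [].
  by apply: preimage_closed => [? _|]; [exact: cg|exact: closed_ge].
have [||t2 /set_mem [/=]] := @compact_EVT_min _ _ id S _ cS.
- by exists b; split; rewrite /= ?in_itv/= ?ab ?lexx// gz.
- by apply: continuous_subspaceT => v; exact: cvg_id.
rewrite in_itv/= => /andP[at2 t2b] ct2 mint2.
have {}mint2 t : a <= t <= b -> c <= z t -> t2 <= t.
  move=> /andP[at' tb] ct; apply: mint2; rewrite inE; split; rewrite /=.
    by rewrite in_itv/= at'.
  by rewrite gz.
rewrite gz// in ct2.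
have [|t /[!in_itv]/= /andP[at' tt2]] := @IVT R g a t2 c at2 (continuous_subspaceT cg).
  by rewrite !gz// ge_min le_max (ltW zac) ct2 orbT.
rewrite gz// => zt.
have tE : t = t2.
  by apply/eqP; rewrite eq_le tt2 mint2 ?at' ?(le_trans tt2)// zt.
rewrite {}tE {t tt2 at'} in zt.
have at2' : a < t2.
  by rewrite lt_neqAle at2 andbT; apply/eqP => E; move: zac; rewrite E zt ltxx.
have [s /andP[sa st] cs] := H _ at2' t2b zt.
have := mint2 s; rewrite sa (le_trans (ltW st) t2b) => /(_ isT cs).
by rewrite leNgt st.
Qed.

Lemma left_near (z : R -> R) (a t e : R) :
  {within `[0, +oo[, continuous z} -> 0 <= a -> a < t -> 0 < e ->
  exists2 s, a <= s < t & forall u, s <= u <= t -> `|z u - z t| < e.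
Proof.
move=> /continuous_max0 cz a0 at' e0.
have := cz t => /cvgrPdist_lt /(_ _ e0) [r /= r0 rP].
exists (Num.max a (t - r / 2)).
  by rewrite le_max lexx gt_max at'/=; lra.
move=> u /andP[]; rewrite ge_max => /andP[au ur] ut.
have := rP u; rewrite /= !max_r; [|lra|lra] => H.
by rewrite distrC H// ger0_norm; lra.
Qed.

Lemma continuous_pos_lb f (a b : R) : continuous f -> a <= b ->
  (forall v, a <= v <= b -> 0 < f v) ->
  exists2 m, 0 < m & forall v, a <= v <= b -> m <= f v.
Proof.
move=> cf ab fp.
have [|c cab Hc] := @EVT_min R f a b ab; first exact: continuous_subspaceT.
exists (f c); first by apply: fp; move: cab; rewrite in_itv.
by move=> v vab; apply: Hc; rewrite in_itv.
Qed.

Lemma continuous_bounded f (c : R) : continuous f ->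
  exists2 k, 0 <= k & forall v, `|v| <= c -> `|f v| <= k.
Proof.
move=> cf; have [c0|c0] := leP 0 c; last first.
  by exists 0 => // v vc; have := normr_ge0 v; lra.
have [||a aab Ha] := @EVT_max R (fun v => `|f v|) (- c) c; first by lra.
  apply: continuous_subspaceT => v; apply: continuous_comp; first exact: cf.
  exact: norm_continuous.
by exists `|f a| => // v; rewrite ler_norml => vc; apply: Ha; rewrite in_itv.
Qed.

Lemma drift_path_not_above f i x n e : drift_path f i x -> continuous f ->
  (forall v, 0 < v -> 0 < f v) ->
  ((exists K, forall u, 0 <= u -> K <= i u) ->
    exists K, forall u, 0 <= u -> i u <= K) ->
  0 <= n -> 0 < e -> ~ forall t, n <= t -> e <= x t.
Proof.
move=> [cx ci h1 h2] cf fp H n0 e0 He.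
have inc t : n <= t -> x t - x n <= i t - i n.
  move=> nt; have := h1 n t 0 n0 nt; rewrite mul0r subr0; apply.
  by move=> u /andP[nu ut]; apply/ltW/fp/(lt_le_trans e0)/He.
have [|K HK] := H.
  have [L L0 HL] := continuous_path_bounded n ci (lexx 0).
  (* The first bound covers [[0, n]]; the second covers later times, where
     [i u >= x u - x n + i n]. *)
  exists (Num.min (- L) (e - x n + i n)) => u u0.
  have [nu|un] := leP n u; rewrite ge_min; apply/orP; [right|left].
    by have := inc u nu; have := He u nu; lra.
  by have := HL u; rewrite u0 ltW// ler_norml => /(_ isT) /andP[].
have xK t : n <= t -> x t <= K - i n + x n.
  by move=> nt; have := inc t nt; have := HK t (le_trans n0 nt); lra.
have [||m m0 Hm] := @continuous_pos_lb f e (K - i n + x n) cf.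
- exact: le_trans (He n (lexx n)) (xK n (lexx n)).
- by move=> v /andP[ev _]; apply: fp; lra.
(* By this time the drift has taken off at least [K - i n + x n], which leaves
   [x t <= i t - K <= 0]. *)
pose t := n + (K - i n + x n) / m.
have K0 : 0 <= K - i n + x n.
  by apply/ltW/(lt_le_trans e0)/(le_trans (He n (lexx n)))/xK.
have nt : n <= t by rewrite lerDl divr_ge0// ltW.
have := h1 n t m n0 nt; have F u : n <= u <= t -> m <= f (x u).
  by move=> /andP[nu ut]; apply: Hm; rewrite He// xK.
have tE : m * (t - n) = K - i n + x n.
  by rewrite /t addrAC subrr add0r mulrC divfK ?gt_eqF.
move=> /(_ F); rewrite tE.
by have := HK t (le_trans n0 nt); have := He t nt; lra.
Qed.

Definition drift_sign f := forall v, v != 0 -> 0 < v * f v.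

Lemma drift_sign_pos f v : drift_sign f -> 0 < v -> 0 < f v.
Proof. by move=> sf v0; have := sf v; rewrite pmulr_rgt0// gt_eqF// => /(_ isT). Qed.

Lemma drift_signN f : drift_sign f -> drift_sign (fun v => - f (- v)).
Proof. by move=> sf v v0; rewrite mulrN -mulNr sf// oppr_eq0. Qed.

Lemma continuous_driftN f : continuous f -> continuous (fun v => - f (- v)).
Proof.
move=> cf v; apply: continuousN; apply: continuous_comp; last exact: cf.
exact: opp_continuous.
Qed.

(** By continuity a path that never enters the interval from [- e] to [e] keeps one sign;
    [drift_path_not_above] excludes it, applied to the path or to its opposite. *)
Lemma drift_path_recurrent f i x n e : drift_path f i x -> continuous f ->
  drift_sign f ->
  ((exists K, forall u, 0 <= u -> K <= i u) ->
    exists K, forall u, 0 <= u -> i u <= K) ->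
  ((exists K, forall u, 0 <= u -> i u <= K) ->
    exists K, forall u, 0 <= u -> K <= i u) ->
  0 <= n -> 0 < e -> exists2 t, n <= t & `|x t| < e.
Proof.
move=> dx cf sf H1 H2 n0 e0; apply: contrapT => H.
have {}H t : n <= t -> x t <= - e \/ e <= x t.
  move=> nt; have [|et] := ltP `|x t| e; first by move=> xe; case: H; exists t.
  by move: et; rewrite lerNr ler_normr => /orP[]; [right|left].
have [cx _ _ _] := dx.
have ivt s t : n <= s -> n <= t -> x s <= - e -> e <= x t -> False.
  move=> ns nt xs xt.
  pose g := fun t : R => x (Num.max 0 t).
  have cg : continuous g := continuous_max0 cx.
  have gx u : n <= u -> g u = x u by move=> nu; rewrite /g max_r// (le_trans n0).
  pose a := Num.min s t; pose b := Num.max s t.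
  have ab : a <= b by rewrite ge_min le_max lexx.
  have [|c /[!in_itv]/= /andP[ac cb] gc] := @IVT R g a b 0 ab (continuous_subspaceT cg).
    rewrite /a /b; case: (leP s t) => st; rewrite ge_min le_max !gx//; lra.
  have nc : n <= c by apply: le_trans ac; rewrite le_min ns.
  by rewrite gx// in gc; have := H c nc; rewrite gc; lra.
have [xn|xn] := H n (lexx n).
  apply: (drift_path_not_above (drift_pathN dx) (continuous_driftN cf) _ _ n0 e0).
  - by move=> v; exact: (drift_sign_pos (drift_signN sf)).
  - move=> [K HK]; have [|L HL] := H2.
      by exists (- K) => u /HK; rewrite lerNr.
    by exists (- L) => u /HL; rewrite lerN2.
  - move=> t nt; have [xt|xt] := H t nt; first by rewrite lerNr.
    by case: (ivt n t).
apply: (drift_path_not_above dx cf _ H1 n0 e0).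
- by move=> v; exact: (drift_sign_pos sf).
- move=> t nt; have [xt|xt] := H t nt; last by [].
  by case: (ivt t n).
Qed.

Lemma continuous_withinB x y : {within `[0, +oo[, continuous x} ->
  {within `[0, +oo[, continuous y} ->
  {within `[0, +oo[, continuous (fun t => x t - y t)}.
Proof.
move=> cx cy v; apply: (@continuousB _ _ (subspace _)); [exact: cx|exact: cy].
Qed.

(** The noise cancels in [x - y]. Within [e / 2] of the level [2 * e] of [x - y], [x] lies between
    [e] and [3 * e], so [f x >= m] outweighs [y <= m / 2] and [x - y] decreases: the level is a
    barrier. *)
Lemma drift_path_stays f i x y e m t0 t :
  drift_path f i x -> drift_path id i y -> 0 < e -> 0 < m ->
  (forall v, e <= v <= 3 * e -> m <= f v) ->
  0 <= t0 -> (forall u, t0 <= u -> `|y u| < e / 2 /\ `|y u| <= m / 2) ->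
  x t0 < e -> t0 <= t -> x t < 3 * e.
Proof.
move=> [cx _ h1 _] [cy _ _ h2] e0 m0 Hm t00 Hy xt0 t0t.
have [] := Hy t t0t; rewrite ltr_norml => /andP[_ yt] _.
suff : x t - y t < 2 * e by lra.
apply: (@barrier (fun u => x u - y u) t0 t) => //; first exact: continuous_withinB.
  by have [] := Hy t0 (lexx t0); rewrite ltr_norml => /andP[? _] _; lra.
move=> r t0r rt zr.
have [s /andP[t0s sr] Hs] := @left_near (fun u => x u - y u) t0 r (e / 2)
  (continuous_withinB cx cy) t00 t0r (ltac:(lra)).
exists s; first by rewrite t0s.
have s0 := le_trans t00 t0s.
have a1 := h1 s r m s0 (ltW sr).
have a2 := h2 s r (m / 2) s0 (ltW sr).
have b1 u : s <= u <= r -> m <= f (x u).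
  move=> sur; apply: Hm; have := Hs u sur; rewrite zr ltr_norml => /andP[c1 c2].
  have [] := Hy u _; first by case/andP: sur => su _; exact: le_trans su.
  by rewrite ltr_norml => /andP[c3 c4] _; lra.
have b2 u : s <= u <= r -> id (y u) <= m / 2.
  move=> /andP[su _]; have [_] := Hy u (le_trans t0s su).
  by rewrite ler_norml => /andP[].
have := a1 b1; have := a2 b2; nra.
Qed.

Lemma drift_path_idN i y : drift_path id i y ->
  drift_path id (fun t => - i t) (fun t => - y t).
Proof.
move=> /drift_pathN [cy ci h1 h2]; split=> // s t m s0 st H.
  by apply: h1 => // u sut; rewrite opprK; exact: H.
by apply: h2 => // u sut; rewrite opprK; exact: H.
Qed.

Lemma drift_path_cvg0 f i x y e : drift_path f i x -> drift_path id i y ->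
  continuous f -> drift_sign f ->
  ((exists K, forall u, 0 <= u -> K <= i u) ->
    exists K, forall u, 0 <= u -> i u <= K) ->
  ((exists K, forall u, 0 <= u -> i u <= K) ->
    exists K, forall u, 0 <= u -> K <= i u) ->
  (forall eta, 0 < eta -> exists T, forall t, T <= t -> `|y t| < eta) ->
  0 < e -> exists T, forall t, T <= t -> `|x t| < 3 * e.
Proof.
move=> dx dy cf sf H1 H2 y0 e0.
have e3 : e <= 3 * e by lra.
have [|m m0 Hm] := @continuous_pos_lb f e (3 * e) cf e3.
  by move=> v /andP[ev _]; apply: drift_sign_pos => //; lra.
have [|m' m'0 Hm'] := @continuous_pos_lb _ e (3 * e) (continuous_driftN cf) e3.
  by move=> v /andP[ev _]; apply: (drift_sign_pos (drift_signN sf)); lra.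
have [|T HT] := y0 (Num.min (e / 2) (Num.min (m / 2) (m' / 2))).
  by rewrite !lt_min; lra.
have {}HT u : T <= u -> [/\ `|y u| < e / 2, `|y u| <= m / 2 & `|y u| <= m' / 2].
  by move=> /HT; rewrite !lt_min => /and3P[? ? ?]; split => //; exact: ltW.
(* One return of [x] near [0] after [y] has become small is enough: the barriers on both sides then
   hold for ever. *)
have [t0 Tt0 xt0] := drift_path_recurrent dx cf sf H1 H2
  (ltac:(by rewrite le_max lexx) : 0 <= Num.max 0 T) e0.
move: Tt0; rewrite ge_max => /andP[t00 Tt0].
move: xt0; rewrite ltr_norml => /andP[xt1 xt2].
exists t0 => t t0t; rewrite ltr_norml; apply/andP; split.
  rewrite ltrNl; apply: (drift_path_stays (drift_pathN dx) _ e0 m'0 Hm' t00 _ _ t0t).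
  - exact: drift_path_idN dy.
  - by move=> u t0u; rewrite normrN; have [] := HT u (le_trans Tt0 t0u).
  - by rewrite ltrNl.
apply: (drift_path_stays dx dy e0 m0 Hm t00 _ _ t0t) => //.
by move=> u t0u; have [] := HT u (le_trans Tt0 t0u).
Qed.

End paths.

(** * Paths with linear drift *)

Section linear_paths.
Context {R : realType}.
Implicit Types (i x y : R -> R).

(** The drift of [y - (i - i n)] is [- y]. Within [m / 2] of a level [c >= 2 * m] one has
    [y >= m / 2], so the level cannot be crossed upwards. *)
Lemma drift_path_id_below i y m c n a t : drift_path id i y -> 0 < m ->
  0 <= n -> (forall u, n <= u <= n + 1 -> `|i u - i n| <= m) ->
  2 * m <= c -> n <= a -> a <= t -> t <= n + 1 ->
  y a - (i a - i n) < c -> y t - (i t - i n) < c.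
Proof.
move=> [cy ci h1 _] m0 n0 Hi mc na at' tn zc.
have a0 := le_trans n0 na.
apply: (@barrier _ (fun u => y u - (i u - i n)) a t) => //.
  apply: continuous_withinB => //; apply: continuous_withinB => //.
  by apply: continuous_subspaceT => v; exact: cvg_cst.
move=> r ar rt zr.
have cz : {within `[0, +oo[, continuous (fun u => y u - (i u - i n))}.
  apply: continuous_withinB => //; apply: continuous_withinB => //.
  by apply: continuous_subspaceT => v; exact: cvg_cst.
have [s /andP[as' sr] Hs] := left_near cz a0 ar (ltac:(lra) : 0 < m / 2).
exists s; first by rewrite as'.
have s0 := le_trans a0 as'.
have := h1 s r (m / 2) s0 (ltW sr).
have b u : s <= u <= r -> m / 2 <= id (y u).
  move=> /andP[su ur]; have := Hs u; rewrite su ur => /(_ isT).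
  rewrite zr ltr_norml => /andP[c1 _].
  have := Hi u; rewrite (le_trans na)/= ?(le_trans as')//.
  by rewrite (le_trans ur (le_trans rt tn)) => /(_ isT); rewrite ler_norml => /andP[]; lra.
by move=> /(_ b) h; nra.
Qed.

(** For the second bound, either [y - (i - i n)] falls below [a / 2 + 2 * m] and stays there, or
    [y >= a / 2 + m] throughout and one unit of time takes off at least that much. *)
Lemma drift_path_id_step i y m a n : drift_path id i y -> 0 < m -> 0 <= n ->
  (forall u, n <= u <= n + 1 -> `|i u - i n| <= m) -> 0 <= a -> y n <= a ->
  (forall t, n <= t <= n + 1 -> y t <= a + 3 * m) /\ y (n + 1) <= a / 2 + 3 * m.
Proof.
move=> dy m0 n0 Hi a0 yna; split=> [t /andP[nt tn]|].
  have := @drift_path_id_below i y m (a + 2 * m) n n t dy m0 n0 Hi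
    (ltac:(lra)) (lexx n) nt tn; rewrite subrr subr0 => /(_ (ltac:(lra))).
  have := Hi t; rewrite nt tn => /(_ isT); rewrite ler_norml => /andP[]; lra.
have n1 : n <= n + 1 by lra.
have := Hi (n + 1); rewrite n1 lexx => /(_ isT); rewrite ler_norml => /andP[i1 i2].
suff : y (n + 1) - (i (n + 1) - i n) <= a / 2 + 2 * m by lra.
have [[u /andP[nu un] zu]|H] := pselect (exists2 u, n <= u <= n + 1 &
    y u - (i u - i n) < a / 2 + 2 * m).
  apply/ltW; exact: (@drift_path_id_below i y m (a / 2 + 2 * m) n u (n + 1) dy m0 n0 Hi
    (ltac:(lra)) nu un (lexx _) zu).
have [_ _ h1 _] := dy; have := h1 n (n + 1) (a / 2 + m) n0 n1.
have b u : n <= u <= n + 1 -> a / 2 + m <= id (y u).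
  move=> nun; rewrite leNgt; apply/negP => h; apply: H; exists u => //.
  by have := Hi u nun; rewrite ler_norml => /andP[] /=; move: h => /=; lra.
by move=> /(_ b); lra.
Qed.

(** Each unit of time turns a bound [a] into [a / 2 + 3 * m], with fixed point [6 * m]. Once
    [b / 2 ^+ k <= m] the bound at integers is [7 * m], and [3 * m] more covers the times
    between. *)
Lemma drift_path_id_bound i y m (N : nat) : drift_path id i y -> 0 < m ->
  (forall n u, (N <= n)%N -> n%:R <= u <= n%:R + 1 -> `|i u - i n%:R| <= m) ->
  exists T, forall t, T <= t -> `|y t| <= 10 * m.
Proof.
move=> dy m0 Hi; have dN := drift_path_idN dy.
have HiN n u : (N <= n)%N -> n%:R <= u <= n%:R + 1 -> `|- i u - - i n%:R| <= m.
  by move=> Nn nun; rewrite -opprD normrN; exact: Hi.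
have step n a : (N <= n)%N -> `|y n%:R| <= a ->
    (forall t, n%:R <= t <= n%:R + 1 -> `|y t| <= a + 3 * m) /\
    `|y n.+1%:R| <= a / 2 + 3 * m.
  move=> Nn yna; have a0 := le_trans (normr_ge0 _) yna.
  move: yna; rewrite ler_norml => /andP[y1 y2].
  have [u1 u2] := drift_path_id_step dy m0 (ler0n R n) (fun u => Hi n u Nn) a0 y2.
  have y3 : - y n%:R <= a by lra.
  have [v1 v2] := drift_path_id_step dN m0 (ler0n R n) (fun u => HiN n u Nn) a0 y3.
  rewrite -[n.+1%:R]natr1; split=> [t nt|]; rewrite ler_norml.
    by apply/andP; have := u1 t nt; have /= := v1 t nt; lra.
  apply/andP; move: v2 => /= v2. lra.
pose b := `|y N%:R|.
have iter k : `|y (N + k)%:R| <= b / 2 ^+ k + 6 * m.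
  elim: k => [|k IH]; first by rewrite addn0 expr0 divr1 /b; lra.
  have [_] := step (N + k)%N _ (leq_addr _ _) IH; rewrite addnS.
  by rewrite exprSr invfM mulrA; lra.
have [k0 hk0] : exists k : nat, b / m < k%:R.
  by exists (Num.truncn (b / m)).+1; exact: truncnS_gt.
have small k : (k0 <= k)%N -> b / 2 ^+ k <= m.
  move=> kk; rewrite ler_pdivrMr ?exprn_gt0// mulrC -ler_pdivrMr//.
  apply/ltW/(lt_le_trans hk0); rewrite -natrX ler_nat.
  by apply: leq_trans kk _; exact/ltnW/ltn_expl.
exists (N + k0)%:R => t Nt.
pose n := Num.truncn t; have t0 : 0 <= t by apply: le_trans Nt.
have /andP[nt tn] := truncn_itv t0.
have Nn : (N + k0 <= n)%N by rewrite truncn_ge_nat.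
have nE : n = (N + (n - N))%N by rewrite subnKC// (leq_trans (leq_addr _ _) Nn).
have kk : (k0 <= n - N)%N by rewrite leq_subRL ?(leq_trans (leq_addr k0 N) Nn).
have := iter (n - N)%N; rewrite -nE => Hn.
have [H _] := step n _ (leq_trans (leq_addr _ _) Nn) Hn.
apply: le_trans (H t _) _; first by rewrite nt natr1 ltW.
by have := small _ kk; lra.
Qed.

(** The equation solved for [i]: the increment of [x] contributes at most [2 * c] and the drift at
    most [k] per unit of time. *)
Lemma drift_path_incr f i x c k s u : drift_path f i x ->
  (forall t, s <= t -> `|x t| <= c) -> (forall v, `|v| <= c -> `|f v| <= k) ->
  0 <= s -> s <= u -> `|i u - i s| <= 2 * c + k * (u - s).
Proof.
move=> [_ _ h1 h2] Hx Hf s0 su.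
have := h1 s u (- k) s0 su; have := h2 s u k s0 su.
have b1 v : s <= v <= u -> f (x v) <= k.
  by move=> /andP[sv _]; have := Hf _ (Hx v sv); rewrite ler_norml => /andP[].
have b2 v : s <= v <= u -> - k <= f (x v).
  by move=> /andP[sv _]; have := Hf _ (Hx v sv); rewrite ler_norml => /andP[].
move=> /(_ b1) e1 /(_ b2) e2.
have := Hx s (lexx s); have := Hx u su; rewrite !ler_norml => /andP[? ?] /andP[? ?].
by apply/andP; split; lra.
Qed.

End linear_paths.

(** * Limit superior and eventual bounds *)

Section limsup.
Context {R : realType} {d : measure_display} {T : measurableType d}.
Implicit Types (X : R -> T -> R).

Lemma limsup_abs_le X w c t0 : (forall t, t0 <= t -> `|X t w| <= c) ->
  (limsup_abs X w <= c%:E)%E.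
Proof.
move=> H; rewrite /limsup_abs /limf_esup; apply: ge_ereal_inf.
exists (ereal_sup ((fun t => `|X t w|%:E) @` `[t0, +oo[%classic)).
  exists `[t0, +oo[%classic => //; exists t0; split; first exact: num_real.
  by move=> t tt; rewrite /= in_itv/= andbT ltW.
apply: ge_ereal_sup => _ [t + <-]; rewrite /= in_itv/= andbT lee_fin.
exact: H.
Qed.

Lemma limsup_abs_lt X w c : (limsup_abs X w < c%:E)%E ->
  exists2 t0, 0 <= t0 & forall t, t0 <= t -> `|X t w| <= c.
Proof.
rewrite /limsup_abs /limf_esup => /ereal_inf_lt[_ [V [t0 [_ HV]] <-] h].
(* The [1] puts [t] strictly beyond [t0], as the open rays defining neighbourhoods of [+oo]
   require. *)
exists (Num.max 0 t0 + 1) => [|t tt]; first by rewrite addr_ge0// le_max lexx.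
rewrite -lee_fin; apply/ltW/(le_lt_trans _ h)/ereal_sup_ubound; exists t => //.
apply: HV; apply: lt_le_trans tt.
have : t0 <= Num.max 0 t0 by rewrite le_max lexx orbT.
lra.
Qed.

End limsup.

(** * Borel-Cantelli for unit increments *)

Section increments_dichotomy.
Context {R : realType} {d : measure_display} {T : measurableType d}.
Variables (P : probability T R) (F : R -> set (set T)) (M : R -> T -> R).
Hypothesis hF : filtration F.
Hypothesis cM : continuous_adapted F M.
Hypothesis hM : sym_indep_incr P F M.
Variable e : R.
Hypothesis e0 : 0 < e.
Notation pr := (pr P).

Let sF t : 0 <= t -> sigma_algebra setT (F t). Proof. by case: hF => + _ _; apply. Qed.
Let mF t : 0 <= t -> F t `<=` measurable. Proof. by case: hF => _ + _; apply. Qed.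
Let ndF s t : 0 <= s -> s <= t -> F s `<=` F t. Proof. by case: hF => _ _; apply. Qed.

Let up n := [set w | e < M n.+1%:R w - M n%:R w].
Let down n := [set w | e < - (M n.+1%:R w - M n%:R w)].
Let jump n := up n `|` down n.
Let n0 n : 0 <= n%:R :> R. Proof. exact: ler0n. Qed.
Let nS n : n%:R <= n.+1%:R :> R. Proof. by rewrite ler_nat. Qed.

Let up_event n : F n.+1%:R (up n).
Proof. exact: (incr_event hF cM). Qed.

Let down_event n : F n.+1%:R (down n).
Proof.
have := incr_event hF (continuous_adaptedN hF cM) e (n0 n) (nS n).
by congr (F _ _); apply/seteqP; split => w; rewrite /down /= opprD opprK.
Qed.

Let m_up n : measurable (up n). Proof. exact: (mF (n0 _) (up_event n)). Qed.
Let m_down n : measurable (down n). Proof. exact: (mF (n0 _) (down_event n)). Qed.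
Let m_jump n : measurable (jump n). Proof. exact: measurableU. Qed.

Let pr_jump n A : measurable A ->
  pr (A `&` jump n) = pr (A `&` up n) + pr (A `&` down n).
Proof.
move=> mA; rewrite (prID P (measurableI _ _ mA (m_jump n)) (m_up n)).
congr (pr _ + pr _); apply/seteqP; split => w.
- by move=> [[Aw _] uw].
- by move=> [Aw uw]; split => //; split => //; left.
- by move=> [[Aw [//|dw]] _].
- move=> [Aw dw]; split; first by split => //; right.
  move=> uw; have h1 : e < M n.+1%:R w - M n%:R w := uw.
  have h2 : e < - (M n.+1%:R w - M n%:R w) := dw.
  by move: e0 h1 h2; lra.
Qed.

Let pr_jumpE n : pr (jump n) = pr (up n) + pr (down n).
Proof. by have := pr_jump n measurableT; rewrite !setTI. Qed.

Let no_jump_indep n A : F n%:R A -> pr (A `\` jump n) = pr A * (1 - pr (jump n)).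
Proof.
move=> FA; have mA := mF (n0 n) FA.
have [h1 h2 _] := hM (n0 n) (nS n).
have := prID P mA (m_jump n); rewrite pr_jump// (h1 _ _ FA) (h2 _ _ FA) pr_jumpE.
by rewrite /up /down; lra.
Qed.

Let quiet N k := \bigcap_(j < k) ~` jump (N + j)%N.

Let quietS N k : quiet N k.+1 = quiet N k `\` jump (N + k)%N.
Proof.
apply/seteqP; split => w.
  move=> H; split; last by apply: H; rewrite /= ltnSn.
  by move=> j /= jk; apply: H; rewrite /= ltnS ltnW.
move=> [H1 H2] j /=; rewrite ltnS leq_eqVlt => /predU1P[->//|jk].
exact: H1.
Qed.

Let quiet_event N k : F (N + k)%:R (quiet N k).
Proof.
elim: k => [|k IH].
  rewrite (_ : quiet _ _ = setT); first exact: (sub_sigma_algebraT (sF (n0 _))).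
  by rewrite -subTset => w _ j.
rewrite quietS addnS; apply: (sub_sigma_algebraI (sF (n0 _))).
  exact: (ndF (n0 _) (nS _)).
apply: (sub_sigma_algebraC (sF (n0 _))).
by apply: (sub_sigma_algebraU (sF (n0 _))).
Qed.

(* [(1 - p) (1 + S + p) <= 1 + S] turns a divergent sum of probabilities into
   a vanishing product. *)
Let quiet_le N k : pr (quiet N k) * (1 + \sum_(j < k) pr (jump (N + j)%N)) <= 1.
Proof.
elim: k => [|k IH].
  by rewrite big_ord0 addr0 mulr1 pr_le1//; exact: (mF (n0 _) (quiet_event _ _)).
rewrite quietS (no_jump_indep (quiet_event N k)) big_ord_recr/=.
set q := pr (quiet N k) in IH *; set S := \sum_(j < k) _ in IH *.
set p := pr _.
have q0 : 0 <= q := pr_ge0 P _.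
have p0 : 0 <= p := pr_ge0 P _.
have S0 : 0 <= S by apply: sumr_ge0 => j _; exact: pr_ge0.
apply: le_trans IH; rewrite -mulrA ler_wpM2l//.
have := mulr_ge0 p0 S0; have := mulr_ge0 p0 p0; lra.
Qed.

(** The cases are a divergent or a convergent sum of jump probabilities. Divergence and independence
    give jumps infinitely often. Under convergence Levy's inequality bounds the probability of a
    large oscillation over [[n, n + 1]] by [2 * pr (jump n)], and the first Borel-Cantelli lemma
    applies. *)
Lemma increments_dichotomy :
  P.-negligible [set w | exists N, forall n, (N <= n)%N ->
    `|M n.+1%:R w - M n%:R w| <= e] \/
  P.-negligible [set w | forall N, exists2 n, (N <= n)%N &
    exists2 u, n%:R <= u <= n%:R + 1 & e < `|M u w - M n%:R w|].
Proof.
have [div|] := pselect (forall N K, exists k, K <= \sum_(j < k) pr (jump (N + j)%N)).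
  left; apply: (@negligibleS _ _ _ _ (\bigcup_N \bigcap_k quiet N k)).
    move=> w [N HN]; exists N => // k _ j _ /=.
    have := HN (N + j)%N (leq_addr _ _); rewrite ler_norml => /andP[h1 h2].
    by move=> [|]; rewrite /up /down /=; lra.
  apply: negligible_bigcup => N.
  have mq k : measurable (quiet N k) by exact: (mF (n0 _) (quiet_event N k)).
  have mQ : measurable (\bigcap_k quiet N k) by exact: bigcap_measurable.
  apply/negligibleP => //; apply: (etrans (prE P mQ)).
  suff -> : pr (\bigcap_k quiet N k) = 0 by [].
  apply/eqP; rewrite eq_le pr_ge0 andbT; apply/ler_addgt0Pr => eta eta0.
  rewrite add0r; have [k Hk] := div N (eta^-1).
  have qk : pr (\bigcap_k quiet N k) <= pr (quiet N k).
    by apply: le_pr => //; exact: bigcap_inf.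
  apply: le_trans qk _.
  have := quiet_le N k; set S := \sum_(j < k) _ in Hk *.
  have q0 := pr_ge0 P (quiet N k) => h.
  have : pr (quiet N k) * eta^-1 <= 1.
    apply: le_trans h; apply: ler_wpM2l => //; lra.
  by rewrite ler_pdivrMr// mul1r.
move=> /existsNP[N /existsNP[K HK]]; right.
have {}HK k : \sum_(j < k) pr (jump (N + j)%N) <= K.
  by rewrite leNgt; apply/negP => h; apply: HK; exists k; exact: ltW.
have cN := continuous_adaptedN hF cM; have hN := sym_indep_incrN hM.
pose E n := exceeds M n%:R n.+1%:R e `|` exceeds (fun t w => - M t w) n%:R n.+1%:R e.
have m1 n : measurable (exceeds M n%:R n.+1%:R e).
  exact: (mF (n0 n.+1) (exceeds_event hF cM _ (n0 n) (nS n))).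
have m2 n : measurable (exceeds (fun t w => - M t w) n%:R n.+1%:R e).
  exact: (mF (n0 n.+1) (exceeds_event hF cN _ (n0 n) (nS n))).
have mE n : measurable (E n) by exact: measurableU.
have FT n : F n%:R setT by exact: (sub_sigma_algebraT (sF (n0 n))).
have prE_le n : pr (E n) <= 2 * pr (jump n).
  apply: le_trans (prU_le P (m1 n) (m2 n)) _; rewrite pr_jumpE mulrDr lerD//.
    by have := levy hF cM hM e (n0 n) (nS n) (FT n); rewrite !setTI.
  have := levy hF cN hN e (n0 n) (nS n) (FT n); rewrite !setTI.
  rewrite (_ : [set w | e < - M n.+1%:R w - - M n%:R w] = down n)//.
  by apply/seteqP; split => w; rewrite /down /= opprD.
apply: (@negligibleS _ _ _ _ (lim_sup_set (fun n => E (N + n)%N))).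
  move=> w Hw k _; have [n Nn [u nu hu]] := Hw (N + k)%N.
  exists (n - N)%N; first by rewrite /= leq_subRL// (leq_trans _ Nn)// leq_addr.
  rewrite /= subnKC ?(leq_trans (leq_addr k N))//.
  move: hu; rewrite ltr_normr => /orP[hu|hu]; [left|right].
    by exists u => //; rewrite -natr1.
  by exists u; rewrite -?natr1//; move: hu; rewrite opprD.
apply/negligibleP.
  by apply: bigcap_measurable => // k _; exact: bigcup_measurable.
apply: lim_sup_set_cvg0 => //; apply: (@le_lt_trans _ _ (2 * K)%:E); last exact: ltry.
apply: lime_le; first exact: is_cvg_nneseries.
apply: nearW => k; rewrite big_mkord.
rewrite (eq_bigr (fun j : 'I_k => (pr (E (N + j)%N))%:E)); last first.
  by move=> j _; exact: prE.
rewrite sumEFin lee_fin; apply: le_trans (_ : _ <= 2 * \sum_(j < k) pr (jump (N + j)%N)) _.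
  by rewrite mulr_sumr ler_sum.
by rewrite ler_pM2l.
Qed.

End increments_dichotomy.

(** * Null sets, and assembly of the three statements *)

Lemma almost_sureC {R : realType} {d} {T : measurableType d}
    (P : probability T R) (E : set T) :
  almost_sure P E -> P.-negligible (~` E).
Proof.
move=> [mE PE]; have mNE := measurableC mE; apply/negligibleP => //.
by apply: (etrans (prE P mNE)); rewrite prC// /pr PE subrr.
Qed.

(** Completeness supplies the measurability of events that involve uncountably many times. *)
Lemma negligibleC_almost_sure {R : realType} {d} {T : measurableType d}
    (P : probability T R) (E : set T) : measure_is_complete P ->
  P.-negligible (~` E) -> almost_sure P E.
Proof.
move=> cP NE; have mE : measurable E by rewrite -(setCK E); exact/measurableC/cP.
split=> //; have h : pr P (~` E) = 0.
  by rewrite /pr (measure_negligible (cP _ NE) NE).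
by rewrite prE//; congr EFin; rewrite prC// in h; lra.
Qed.

Lemma not_negligible_setT {R : realType} {d} {T : measurableType d}
    (P : probability T R) (N : set T) :
  P.-negligible N -> exists w, ~ N w.
Proof.
move=> NN; apply: contrapT => /forallNP H.
have : P.-negligible [set: T].
  by apply: negligibleS NN => w _; apply: contrapT; exact: H.
move=> /(measure_negligible measurableT) h.
have := probability_setT P.
by rewrite (_ : P setT = 0%E)// => /eqP; rewrite eq_sym onee_eq0.
Qed.

Lemma cvg0_drift_path {R : realType} (x : R -> R) :
  (forall e, 0 < e -> exists t0, forall t, t0 <= t -> `|x t| < 3 * e) ->
  x t @[t --> +oo] --> (0 : R).
Proof.
move=> H; apply/cvgrPdist_lt => e e0.
have [t0 Ht0] := H (e / 3) (ltac:(lra)).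
exists t0; split; first exact: num_real.
move=> t t0t; rewrite /= sub0r normrN; apply: lt_le_trans (Ht0 t (ltW t0t)) _.
lra.
Qed.

Theorem proposition5 (R : realType) (d : measure_display) (T : measurableType d)
  (P : probability T R) (F : R -> set (set T)) (B : R -> T -> R)
  (f sigma : R -> R) (xi : R) (I X Y : R -> T -> R)
  (hF : complete_filtered_probability P F)
  (hB : brownian_motion P F B)
  (f_cont : continuous f)
  (f_sign : forall x : R, x != 0 -> 0 < x * f x)
  (f0 : f 0 = 0)
  (sigma_cont : {within `[0, +oo[, continuous sigma})
  (hI : ito_integral P F B (fun s _ => sigma s) I)
  (hX : solution P F f xi I X)
  (hY : solution P F id 0 I Y) :
  let OmegaX := equation_event f xi I X in
  let OmegaY := equation_event id 0 I Y in
  let Omega1 := OmegaY `&`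
    [set w | (0 < limsup_abs Y w)%E /\ (limsup_abs Y w < +oo)%E] in
  let Omega2 := Omega1 `&` OmegaX in
  (* (A) *)
  (almost_sure P (OmegaY `&` [set w | `|Y t w| @[t --> +oo] --> (0 : R)]) ->
   almost_sure P [set w | X t w @[t --> +oo] --> (0 : R)]) /\
  (* (B): OmegaX and OmegaY are determined only up to a null set (I is), and the
     infimum is the pointwise one over Omega2 once a suitable null set N0 is
     discarded; discarding more does not change its value. *)
  (almost_sure P Omega1 ->
   almost_sure P Omega2 /\
   exists2 Xlow : \bar R, (0 < Xlow)%E &
     exists2 N0 : set T, P.-negligible N0 &
       forall N : set T, P.-negligible N -> N0 `<=` N ->
         Xlow = ereal_inf [set limsup_abs X w | w in Omega2 `\` N]) /\
  (* (C) *)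
  (almost_sure P (OmegaY `&` [set w | limsup_abs Y w = +oo%E]) ->
   almost_sure P [set w | limsup_abs X w = +oo%E]).
Proof.
move=> OmegaX OmegaY Omega1 Omega2.
have [filF cP _] := hF.
have [cI _] := hI.
have hM : sym_indep_incr P F I.
  move=> s t s0 st; split => [A c FA|A c FA|c].
  - exact: (ito_incr_indep filF hB sigma_cont hI).
  - exact: (ito_incr_indepN filF hB sigma_cont hI).
  - exact: (ito_incr_sym filF hB sigma_cont hI).
have dX w : OmegaX w -> drift_path f (I ^~ w) (X ^~ w).
  have [[cX _] _] := hX; have [cIw _] := cI.
  by move=> Xw; exact: (integral_drift_path f_cont (cX w) (cIw w) Xw).
have dY w : OmegaY w -> drift_path id (I ^~ w) (Y ^~ w).
  have [[cY _] _] := hY; have [cIw _] := cI.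
  by move=> Yw; apply: (integral_drift_path _ (cY w) (cIw w) Yw) => v; exact: cvg_id.
have NX : P.-negligible (~` OmegaX) by have [_ /almost_sureC] := hX.
have NY : P.-negligible (~` OmegaY) by have [_ /almost_sureC] := hY.
have Yle w m (N : nat) : OmegaY w -> 0 < m ->
    (forall n u, (N <= n)%N -> n%:R <= u <= n%:R + 1 -> `|I u w - I n%:R w| <= m) ->
    (limsup_abs Y w <= (10 * m)%:E)%E.
  move=> Yw m0 H; have [t0 Ht0] := drift_path_id_bound (dY w Yw) m0 H.
  exact: limsup_abs_le Ht0.
split; [|split].
- move=> /almost_sureC NA; apply: negligibleC_almost_sure => //.
  have N1 := bounded_below_bounded_above filF cI hM.
  (* For [- I] the lemma gives the converse: paths of [I] bounded above are a.s. bounded below. *)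
  have N2 := bounded_below_bounded_above filF (continuous_adaptedN filF cI)
    (sym_indep_incrN hM).
  apply: negligibleS (negligibleU (negligibleU NA NX) (negligibleU N1 N2)).
  move=> w /= nX; apply: contrapT => /not_orP[/not_orP[/contrapT[Yw Y0] /contrapT Xw]].
  move=> /not_orP[/not_andP h1 /not_andP h2]; apply: nX.
  apply: cvg0_drift_path => e e0.
  apply: (drift_path_cvg0 (dX w Xw) (dY w Yw) f_cont f_sign) => //.
  + move=> bb; case: h1 => [//|/contrapT]; exact.
  + move=> [K HK]; case: h2 => [h2|/contrapT[L HL]].
      by case: h2; exists (- K) => u u0; rewrite lerN2 HK.
    by exists (- L) => u u0; rewrite lerNl HL.
  + move=> eta eta0; have /cvgrPdist_lt /(_ _ eta0) [t0 [_ Ht0]] := Y0.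
    exists (t0 + 1) => t tt; have := Ht0 t; rewrite /= sub0r normrN normr_id; apply.
    lra.
- move=> as1; have N1 := almost_sureC as1; split.
    apply: negligibleC_almost_sure => //; rewrite setCI; exact: negligibleU.
  (* Otherwise the unit oscillations of [I] would a.s. be eventually below every [1/(k+1)], so
     [limsup_abs Y] would be at most [10/(k+1)] for all [k]; a single path of [Omega1] contradicts
     this. *)
  have [e e0 Ne] : exists2 e, 0 < e & P.-negligible [set w | exists N, forall n,
      (N <= n)%N -> `|I n.+1%:R w - I n%:R w| <= e].
    apply: contrapT => H.
    have {}H e : 0 < e -> P.-negligible [set w | forall N, exists2 n, (N <= n)%N &
        exists2 u, n%:R <= u <= n%:R + 1 & e < `|I u w - I n%:R w|].
      move=> e0; have [h|//] := increments_dichotomy filF cI hM e0.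
      by case: H; exists e.
    pose N k := [set w | forall N, exists2 n, (N <= n)%N &
        exists2 u, n%:R <= u <= n%:R + 1 & k.+1%:R^-1 < `|I u w - I n%:R w|].
    have NN : P.-negligible (\bigcup_k N k).
      by apply: negligible_bigcup => k; apply: H; rewrite invr_gt0.
    have [w /not_orP[/contrapT[Yw [Y0 Yoo]] Nw]] :=
      not_negligible_setT (negligibleU N1 NN).
    have Yk k : (limsup_abs Y w <= (10 * k.+1%:R^-1)%:E)%E.
      have /existsNP[n0 Hn0] : ~ N k w by move=> h; apply: Nw; exists k.
      apply: (@Yle w _ n0) => // n u n0n nu; rewrite leNgt; apply/negP => h.
      by apply: Hn0; exists n => //; exists u.
    move: Y0 Yoo Yk; case: (limsup_abs Y w) => [r| |]//; rewrite lte_fin => r0 _ Yk.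
    have [k hk] : exists k : nat, 10 / r < k%:R.
      by exists (Num.truncn (10 / r)).+1; exact: truncnS_gt.
    have := Yk k; rewrite lee_fin ler_pdivlMr// leNgt => /negP; apply.
    move: hk; rewrite ltr_pdivrMr// -[k.+1%:R]natr1; lra.
  have [x0 x0_gt0 Hx0] : exists2 x0, 0 < x0 & forall w, OmegaX w ->
      ~ (exists N, forall n, (N <= n)%N -> `|I n.+1%:R w - I n%:R w| <= e) ->
      (x0%:E <= limsup_abs X w)%E.
    have := f_cont 0 => /cvgrPdist_lt /(_ (e / 2)) [|r /= r0 Hr]; first lra.
    (* Below this level [|f| <= e / 2], because [f 0 = 0]. If [|X|] stayed there, unit increments of
       [I] would be at most [2 * (e / 4) + e / 2 = e]. *)
    exists (Num.min (r / 2) (e / 4)); first by rewrite lt_min; lra.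
    move=> w Xw nw; rewrite leNgt; apply/negP => /limsup_abs_lt[t0 t00 Ht0].
    apply: nw; exists (Num.truncn t0).+1 => n t0n.
    have tn : t0 <= n%:R by apply/ltW; rewrite -truncn_lt_nat.
    have := @drift_path_incr _ f (I ^~ w) (X ^~ w) (Num.min (r / 2) (e / 4)) (e / 2)
      n%:R n.+1%:R (dX w Xw).
    move=> H; apply: le_trans (H _ _ _ _) _ => //.
    + by move=> t nt; apply: Ht0; exact: le_trans nt.
    + move=> v; rewrite le_min => /andP[vr _]; have := Hr v.
      by rewrite /= f0 !sub0r !normrN => h; apply/ltW/h; lra.
    + by rewrite ler_nat.
    + have : Num.min (r / 2) (e / 4) <= e / 4 by rewrite ge_min lexx orbT.
      by rewrite -[n.+1%:R]natr1 addrAC subrr add0r; lra.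
  pose Xlow := ess_inf P (limsup_abs X).
  have aeX : \forall w \ae P, (Xlow <= limsup_abs X w)%E by exact: ess_inf_le.
  have Nlow : P.-negligible (~` [set w | (Xlow <= limsup_abs X w)%E]) by exact: aeX.
  exists Xlow.
    apply: (@lt_le_trans _ _ x0%:E); first by rewrite lte_fin.
    apply/ess_infP; apply: negligibleS (negligibleU NX Ne) => w /= h.
    apply: contrapT => /not_orP[/contrapT Xw nw]; apply: h; exact: Hx0.
  (* Removing this null set makes [Xlow] a lower bound. Conversely, almost every path lies in
     [Omega2] outside [N], so the infimum there is an essential lower bound, hence at most
     [Xlow]. *)
  exists (~` [set w | (Xlow <= limsup_abs X w)%E]) => // N nN subN.
  apply/eqP; rewrite eq_le; apply/andP; split.
    apply: le_ereal_inf_tmp => _ [w [_ nNw] <-].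
    by apply: contrapT => h; apply: nNw; apply: subN.
  apply/ess_infP; apply: negligibleS (negligibleU (negligibleU N1 NX) nN) => w /= h.
  apply: contrapT => /not_orP[/not_orP[/contrapT w1 /contrapT w2] nNw]; apply: h.
  by apply: ereal_inf_lbound; exists w.
- move=> /almost_sureC NC; apply: negligibleC_almost_sure => //.
  apply: negligibleS (negligibleU NC NX) => w /= nX.
  apply: contrapT => /not_orP[/contrapT[Yw Yoo] /contrapT Xw]; apply: nX.
  apply/eqP; rewrite -leye_eq leNgt; apply/negP => Xfin.
  have [c Hc] : exists c : R, (limsup_abs X w < c%:E)%E.
    move: Xfin; case: (limsup_abs X w) => [r| |]// _.
      by exists (r + 1); rewrite lte_fin ltrDl.
    by exists 0; rewrite ltNyr.
  have [t0 t00 Ht0] := limsup_abs_lt Hc.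
  have [k k0 Hk] := continuous_bounded c f_cont.
  have c0 : 0 <= c := le_trans (normr_ge0 _) (Ht0 t0 (lexx t0)).
  (* Unit oscillations of [I] are at most [2 * c + k]; the [1] makes the bound positive. *)
  have := @Yle w (2 * c + k + 1) (Num.truncn t0).+1 Yw (ltac:(lra)).
  rewrite Yoo leNgt ltry => H; suff : False by [].
  (* As [limsup_abs Y w = +oo], the conclusion of [Yle] has become false; its oscillation premise
     remains to be verified. *)
  apply: Bool.diff_false_true; apply: H => n u t0n /andP[nu un].
  have tn : t0 <= n%:R by apply/ltW; rewrite -truncn_lt_nat.
  apply: le_trans (drift_path_incr (dX w Xw) _ Hk (ler0n R n) nu) _.
    by move=> t nt; apply: Ht0; exact: le_trans nt.
  have : k * (u - n%:R) <= k * 1 by apply: ler_wpM2l => //; lra.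
  lra.
Qed.
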